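(* Consider the following system of partial differential equations for two unknown functions $u,\bar m$ (nowhere zero) of two variables $(z^1,z^2)$: $$(L)\qquad \bar m_{z^1z^2}=\gamma_1\bar m_{z^2}+\gamma_2\bar m_{z^1},$$ $$(C)\qquad \bar m_{z^2z^2}=-\left(\gamma_1\bar m_{z^1}-\gamma_2\bar m_{z^2}\right)+\bar m\left(u^2+\operatorname{div}\gamma\right),$$ where $\gamma_i=\frac1u\frac{\partial u}{\partial z^i}$ and $\operatorname{div}\gamma=\frac{\partial\gamma_1}{\partial z^1}+\frac{\partial\gamma_2}{\partial z^2}$. In the real-analytic category this system has (local) solutions. Moreover, these solutions depend in the Cartan–Kähler sense on 4 functions of 1 variable.
   Context: Subscripts $z^i$ denote partial derivatives. ''Depend in the Cartan–Kähler sense on 4 functions of 1 variable'' is meant as follows. Let $J^2(\mathbb{R}^2,\mathbb{R}^2)$ be the space of 2-jets of pairs $(\bar m,u)$ of functions of $(z^1,z^2)$, let $C^2$ be its canonical contact system, generated by $$d\bar m-\bar m_{z^1}dz^1-\bar m_{z^2}dz^2,\quad d\bar m_{z^i}-\bar m_{z^iz^1}dz^1-\bar m_{z^iz^2}dz^2,\quad du-u_{z^1}dz^1-u_{z^2}dz^2,\quad du_{z^i}-u_{z^iz^1}dz^1-u_{z^iz^2}dz^2\quad(i=1,2),$$ let $R\subset J^2(\mathbb{R}^2,\mathbb{R}^2)$ be the submanifold defined by (L) and (C), and consider the restriction $C^2|_R$ with independence condition $dz^1\wedge dz^2\ne0$. The solutions depend on $p$ functions of $l$ variables if this linear Pfaffian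 system is involutive and its last nonzero reduced character is $s_l=p$. Linear Pfaffian systems. Let $N$ be a manifold with pointwise linearly independent 1-forms $\theta^a$ ($1\le a\le s$) and $\omega^i$ ($1\le i\le n$). The pair $(\{\theta^a\},\{\theta^a,\omega^i\})$ is a linear Pfaffian system with independence condition $\omega^1\wedge\dots\wedge\omega^n\ne0$ if $d\theta^a\equiv 0 \bmod \{\theta^b,\omega^i\}$ for all $a$. Completing to a local coframing by 1-forms $\pi^\epsilon$, one has $d\theta^a\equiv A^a_{\epsilon i}\,\pi^\epsilon\wedge\omega^i+T^a_{ij}\,\omega^i\wedge\omega^j \bmod \{\theta^b\}$. The apparent torsion is absorbable if the $\pi^\epsilon$ can be rechosen so that all $T^a_{ij}=0$. The tableau at $x\in N$ is the linear subspace $A\subset W\otimes V^*$ (with $\dim W=s$, $\dim V=n$) spanned by the matrices $(A^a_{\epsilon i}(x))_{a,i}$. For a basis of $V^*$ let $s_1+\dots+s_k$ be the number of independent entries in the first $k$ columns of $A$; the reduced characters $s_1,\dots,s_n$ are obtained by successively maximizing $s_1$, then $s_2$, and so on, over all bases (flags). The tableau is involutive if $\dim A^{(1)}=s_1+2s_2+\dots+ns_n$, where $A^{(1)}=(A\otimes V^* )\cap(W\otimes S^2V^* )$. The linear Pfaffian system is involutive if at every point the apparent torsion is absorbable and the tableau is involutive. *)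

(* Defs.v *)
From HB Require Import structures.
From mathcomp Require Import all_boot all_order all_algebra.
From mathcomp Require Import all_classical all_reals all_analysis.
Set Implicit Arguments.
Unset Strict Implicit.
Unset Printing Implicit Defensive.
Import Order.TTheory GRing.Theory Num.Theory.
Import numFieldNormedType.Exports.
Local Open Scope classical_set_scope.
Local Open Scope ring_scope.

(** * Tableaux *)

(* W (x) V^* is 'M_(s, n): row a is the W-index, column i the V^*-index. *)
Section Tableau.
Variables (K : fieldType) (s n : nat).
Implicit Types (A : {vspace 'M[K]_(s, n)}) (g : 'M[K]_n).

(* The invertible matrix g encodes a basis of V^*: a tableau element M reads
   M *m g in that basis.  The number of independent entries in its first k
   columns is the dimension of the projection of A to those columns. *)
Definition column_rank A g (k : nat) : nat :=
  \dim (linfun (fun M : 'M[K]_(s, n) => M *m g *m (pid_mx k : 'M[K]_n)) @: A)%VS.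

Definition flag_character A g (k : nat) : nat :=
  (column_rank A g k - column_rank A g k.-1)%N.

(* g successively maximizes s_1, then s_2, ..., then s_k. *)
Fixpoint maximizing_flag A (k : nat) g : Prop :=
  if k is k'.+1 then
    maximizing_flag A k' g /\
    forall g', maximizing_flag A k' g' ->
      (flag_character A g' k <= flag_character A g k)%N
  else g \in unitmx.

(* Characters are numbered from 1 to n; the value at other indices is free. *)
Definition reduced_characters A (ch : nat -> nat) : Prop :=
  exists2 g, maximizing_flag A n g &
    forall k, (1 <= k <= n)%N -> ch k = flag_character A g k.

(* P in W (x) V^* (x) V^* is stored as its slices P j along the last factor. *)
Definition prolongation A : {vspace {ffun 'I_n -> 'M[K]_(s, n)}} :=
  ((\bigcap_(j < n) (linfun (fun P : {ffun 'I_n -> 'M[K]_(s, n)} => P j) @^-1: A))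
   :&: lker (linfun (fun P : {ffun 'I_n -> 'M[K]_(s, n)} =>
               [ffun j => \matrix_(a < s, i < n) (P j a i - P i a j)])))%VS.

Lemma prolongationP A (P : {ffun 'I_n -> 'M[K]_(s, n)}) :
  reflect ((forall j, P j \in A) /\ (forall a i j, P j a i = P i a j))
          (P \in prolongation A).
Proof.
pose ev j (Q : {ffun 'I_n -> 'M[K]_(s, n)}) := Q j.
pose asym (Q : {ffun 'I_n -> 'M[K]_(s, n)}) :=
  [ffun j => \matrix_(a < s, i < n) (Q j a i - Q i a j)].
have evL j : linear (ev j) by move=> c Q Q'; rewrite /ev !ffunE.
have asymL : linear asym.
  move=> c Q Q'; apply/ffunP => j; apply/matrixP => a i.
  by rewrite !ffunE !mxE !ffunE !mxE mulrBr opprD addrACA.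
pose evM j := GRing.isLinear.Build _ _ _ _ (ev j) (evL j).
pose evl j : {linear _ -> _} := HB.pack (ev j) (evM j).
pose asM := GRing.isLinear.Build _ _ _ _ asym asymL.
pose asl : {linear _ -> _} := HB.pack asym asM.
have memI (I : seq 'I_n) (F : 'I_n -> {vspace {ffun 'I_n -> 'M[K]_(s, n)}}) :
    (P \in (\bigcap_(j <- I) F j)%VS) = all (fun j => P \in F j) I.
  elim: I => [|j I IH]; first by rewrite big_nil memvf.
  by rewrite big_cons memv_cap IH.
rewrite /prolongation memv_cap memI; apply: (iffP andP) => -[].
  move=> /allP PA Pk; split=> [j|a i j].
    have := PA j; rewrite mem_index_enum => /(_ isT).
    by rewrite -memv_preim (lfunE (evl j)).
  move: Pk; rewrite memv_ker (lfunE asl) => /eqP /ffunP /(_ j) /matrixP /(_ a i).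
  by rewrite /= !ffunE !mxE => /eqP; rewrite subr_eq0 => /eqP.
move=> PA Ps; split.
  by apply/allP => j _; rewrite -memv_preim (lfunE (evl j)); exact: PA.
rewrite memv_ker (lfunE asl); apply/eqP/ffunP => j; apply/matrixP => a i.
by rewrite /= !ffunE !mxE Ps subrr.
Qed.

Definition involutive_tableau A : Prop :=
  exists2 ch, reduced_characters A ch &
    \dim (prolongation A) = (\sum_(1 <= k < n.+1) k * ch k)%N.

Definition last_character A (l p : nat) : Prop :=
  [/\ (1 <= l <= n)%N, (0 < p)%N &
   exists2 ch, reduced_characters A ch &
     ch l = p /\ forall k, (l < k <= n)%N -> ch k = 0%N].

End Tableau.

(** * Linear Pfaffian systems on a submanifold of R^D *)

Section Pfaffian.
Variables (R : realType) (D : nat).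

(* Vectors are rows and covectors are columns; a family of k one-forms is a
   field of D x k matrices, one column for each form. *)
Definition pairing (v : 'rV[R]_D) (al : 'cV[R]_D) : R := (v *m al) 0 0.

Definition wedge (al be : 'cV[R]_D) (v w : 'rV[R]_D) : R :=
  pairing v al * pairing w be - pairing w al * pairing v be.

(* d theta (v, w) for constant vector fields v and w. *)
Definition exterior_d (th : 'rV[R]_D -> 'cV[R]_D) (x v w : 'rV[R]_D) : R :=
  pairing w ('D_v th x) - pairing v ('D_w th x).

(* The manifold N is the part of the zero set of [equations] lying in the open
   set [domain]; the forms on N are restrictions of forms on R^D. *)
Record pfaffian_system (c s n : nat) := PfaffianSystem {
  domain : set 'rV[R]_D;
  equations : 'rV[R]_D -> 'rV[R]_c;
  theta : 'rV[R]_D -> 'M[R]_(D, s);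
  omega : 'rV[R]_D -> 'M[R]_(D, n) }.

Section System.
Variables (c s n : nat) (S : pfaffian_system c s n).

Definition manifold : set 'rV[R]_D := domain S `&` [set x | equations S x = 0].

(* T_x N, as the row space of a matrix. *)
Definition tangent (x : 'rV[R]_D) : 'M[R]_D := kermx (jacobian (equations S) x).

Definition submanifold : Prop :=
  open (domain S) /\ forall x, manifold x ->
    differentiable (equations S) x /\ \rank (jacobian (equations S) x) = c.

Definition independent_at x k (al : 'M[R]_(D, k)) : bool :=
  \rank (tangent x *m al) == k.

Definition coframe_at x k (al : 'M[R]_(D, k)) : bool :=
  independent_at x al && (\rank (tangent x) == k).

(* d restricts to N by naturality: (d theta)|_{T_x N} = d (theta|_N). *)
Definition dtheta x (a : 'I_s) : 'rV[R]_D -> 'rV[R]_D -> R :=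
  exterior_d (fun y => col a (theta S y)) x.

Definition linear_pfaffian : Prop :=
  submanifold /\ forall x, manifold x ->
    independent_at x (row_mx (theta S x) (omega S x)) /\
    forall a, exists (be : 'I_s -> 'cV[R]_D) (ga : 'I_n -> 'cV[R]_D),
      forall v w, (v <= tangent x)%MS -> (w <= tangent x)%MS ->
        dtheta x a v w = \sum_b wedge (be b) (col b (theta S x)) v w
                       + \sum_i wedge (ga i) (col i (omega S x)) v w.

(* dtheta^a = A^a_{e i} pi^e /\ omega^i + T^a_{ij} omega^i /\ omega^j
   mod {theta^b} on T_x N, where (theta, omega, pi) is a coframe of N at x. *)
Definition structure_equations x r (Pi : 'M[R]_(D, r))
    (A : 'I_r -> 'M[R]_(s, n)) (T : 'I_s -> 'M[R]_n) : Prop :=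
  coframe_at x (row_mx (row_mx (theta S x) (omega S x)) Pi) /\
  forall a, exists be : 'I_s -> 'cV[R]_D,
    forall v w, (v <= tangent x)%MS -> (w <= tangent x)%MS ->
      dtheta x a v w =
        \sum_e \sum_i A e a i * wedge (col e Pi) (col i (omega S x)) v w
      + \sum_i \sum_j T a i j * wedge (col i (omega S x)) (col j (omega S x)) v w
      + \sum_b wedge (be b) (col b (theta S x)) v w.

Definition tableau_at x (A : {vspace 'M[R]_(s, n)}) : Prop :=
  exists r (Pi : 'M[R]_(D, r)) (As : 'I_r -> 'M[R]_(s, n)) T,
    structure_equations x Pi As T /\ A = <<codom As>>%VS.

Definition absorbable_torsion x : Prop :=
  exists r (Pi : 'M[R]_(D, r)) (As : 'I_r -> 'M[R]_(s, n)),
    structure_equations x Pi As (fun=> 0).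

Definition involutive : Prop :=
  forall x, manifold x ->
    absorbable_torsion x /\ forall A, tableau_at x A -> involutive_tableau A.

(* Solutions depend on p functions of l variables, in the Cartan-Kaehler
   sense.  Involutivity provides a tableau at every point. *)
Definition cartan_kaehler_dependence (p l : nat) : Prop :=
  [/\ linear_pfaffian, involutive &
      forall x, manifold x -> forall A, tableau_at x A -> last_character A l p].

End System.
End Pfaffian.

(** * Real-analytic functions of two variables *)

Section PDE.
Variable R : realType.
Implicit Types (f u m : R -> R -> R) (x y : R).

Definition analytic_at f x y : Prop :=
  exists (c : nat -> nat -> R) (r : R), 0 < r /\
    forall h k, `|h| < r -> `|k| < r ->
      cvgn (series (fun d => \sum_(i < d.+1) `|c i (d - i)%N * h ^+ i * k ^+ (d - i)|)) /\
      series (fun d => \sum_(i < d.+1) c i (d - i)%N * h ^+ i * k ^+ (d - i)) @ \oo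
        --> f (x + h) (y + k).

Definition d1 f : R -> R -> R := fun x y => derive1 (fun t => f t y) x.
Definition d2 f : R -> R -> R := fun x y => derive1 (fun t => f x t) y.

(** * The system (L), (C) *)

Definition gamma1 u : R -> R -> R := fun x y => d1 u x y / u x y.
Definition gamma2 u : R -> R -> R := fun x y => d2 u x y / u x y.
Definition div_gamma u : R -> R -> R :=
  fun x y => d1 (gamma1 u) x y + d2 (gamma2 u) x y.

Definition eqL m u x y : Prop :=
  d2 (d1 m) x y = gamma1 u x y * d2 m x y + gamma2 u x y * d1 m x y.

Definition eqC m u x y : Prop :=
  d2 (d2 m) x y = - (gamma1 u x y * d1 m x y - gamma2 u x y * d2 m x y)
                  + m x y * (u x y ^+ 2 + div_gamma u x y).

Definition analytic_solution (U : set (R * R)) m u : Prop :=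
  forall x y, U (x, y) ->
    [/\ analytic_at m x y /\ analytic_at u x y,
        m x y != 0 /\ u x y != 0, eqL m u x y & eqC m u x y].

(** * The contact system of J^2(R^2, R^2) restricted to the equations *)

(* Standard coordinates on J^2(R^2, R^2) = R^14. *)
Definition jz1  : 'I_14 := @Ordinal 14 0 isT.
Definition jz2  : 'I_14 := @Ordinal 14 1 isT.
Definition jm   : 'I_14 := @Ordinal 14 2 isT.
Definition jm1  : 'I_14 := @Ordinal 14 3 isT.
Definition jm2  : 'I_14 := @Ordinal 14 4 isT.
Definition jm11 : 'I_14 := @Ordinal 14 5 isT.
Definition jm12 : 'I_14 := @Ordinal 14 6 isT.
Definition jm22 : 'I_14 := @Ordinal 14 7 isT.
Definition ju   : 'I_14 := @Ordinal 14 8 isT.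
Definition ju1  : 'I_14 := @Ordinal 14 9 isT.
Definition ju2  : 'I_14 := @Ordinal 14 10 isT.
Definition ju11 : 'I_14 := @Ordinal 14 11 isT.
Definition ju12 : 'I_14 := @Ordinal 14 12 isT.
Definition ju22 : 'I_14 := @Ordinal 14 13 isT.

Definition jet2 m u x y : 'rV[R]_14 :=
  \row_k nth 0 [:: x; y;
    m x y; d1 m x y; d2 m x y; d1 (d1 m) x y; d2 (d1 m) x y; d2 (d2 m) x y;
    u x y; d1 u x y; d2 u x y; d1 (d1 u) x y; d2 (d1 u) x y; d2 (d2 u) x y] k.

Definition jet_gamma1 (j : 'rV[R]_14) : R := j 0 ju1 / j 0 ju.
Definition jet_gamma2 (j : 'rV[R]_14) : R := j 0 ju2 / j 0 ju.

(* The quotient rule: d_i (u_i / u) = u_ii / u - (u_i / u)^2. *)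
Definition jet_div_gamma (j : 'rV[R]_14) : R :=
    (j 0 ju11 / j 0 ju - jet_gamma1 j ^+ 2)
  + (j 0 ju22 / j 0 ju - jet_gamma2 j ^+ 2).

Definition jet_equations (j : 'rV[R]_14) : 'rV[R]_2 :=
  \row_i nth 0 [::
    j 0 jm12 - (jet_gamma1 j * j 0 jm2 + jet_gamma2 j * j 0 jm1);
    j 0 jm22 - (- (jet_gamma1 j * j 0 jm1 - jet_gamma2 j * j 0 jm2)
                + j 0 jm * (j 0 ju ^+ 2 + jet_div_gamma j))] i.

Definition dcoord (k : 'I_14) : 'cV[R]_14 := delta_mx k 0.

Definition contact_form (f f1 f2 : 'I_14) (j : 'rV[R]_14) : 'cV[R]_14 :=
  dcoord f - j 0 f1 *: dcoord jz1 - j 0 f2 *: dcoord jz2.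

Definition contact_forms (j : 'rV[R]_14) : 'M[R]_(14, 6) :=
  \matrix_(k, a) (nth 0 [::
    contact_form jm jm1 jm2 j; contact_form jm1 jm11 jm12 j;
    contact_form jm2 jm12 jm22 j;
    contact_form ju ju1 ju2 j; contact_form ju1 ju11 ju12 j;
    contact_form ju2 ju12 ju22 j] a) k 0.

Definition independence_forms (_ : 'rV[R]_14) : 'M[R]_(14, 2) :=
  row_mx (dcoord jz1) (dcoord jz2).

Definition restricted_contact_system : pfaffian_system R 14 2 6 2 :=
  PfaffianSystem [set j | j 0 jm != 0 /\ j 0 ju != 0]
    jet_equations contact_forms independence_forms.

End PDE.

(* Main.v *)
Require Import Defs.
From HB Require Import structures.
From mathcomp Require Import all_boot all_order all_algebra.
From mathcomp Require Import all_classical all_reals all_analysis.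
From mathcomp Require Import ring lra zify.
Set Implicit Arguments.
Unset Strict Implicit.
Unset Printing Implicit Defensive.
Import Order.TTheory GRing.Theory Num.Theory.
Import numFieldNormedType.Exports.
Local Open Scope classical_set_scope.
Local Open Scope ring_scope.

(* Existence.  Put m = m0 + M and u = u0 + U around the base point.  The system
   is solved for the leading derivatives m_12 and u_11; the power series of M and
   U are free on the coordinate axes (for M) and in the columns 0 and 1 (for U),
   where polynomials realize the given 2-jet.  For the weight 2i + j on the
   monomials x^i y^j each leading derivative outweighs the other derivatives in
   its equation, so the Picard iterates of the coefficients are eventually
   constant.  The iteration preserves a ball of the majorants
   a th^i rho^(i+j) n! / (8 (n+1)^2), n = i + j - 2, for the values of the
   derivatives at the base point, so the series converge.
   Involutivity.  At every point the tableau consists of the symbols with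
   m_12 = 0 and m_22 = (m / u) (u_11 + u_22).  It has dimension 4, its projection
   to the noncharacteristic direction dz1 + dz2 is injective, whence s_1 = 4 and
   s_2 = 0, and its prolongation has dimension 4 too. *)

(** * Geometrically bounded series *)

(** The system is not in Cauchy-Kovalevskaya form: both coordinate directions are characteristic for
    (L), and (C) is solved for the [u_11] hidden in the divergence, so that [m_22] and [u_22], of
    the same differential order, stay on the right-hand side. Two devices overcome this. The leading
    coefficients are frozen at the base point, as in [u0 m_12 = - U m_12 + ...]; the leading
    derivatives then recur on the right only with factors that vanish there, which are harmless both
    for the weight and, at small amplitude, for the majorants. The remaining terms of equal order
    have constant coefficients of no particular size; they are beaten by anisotropy, since a
    derivative in [x] is allowed a factor [th * rho] and one in [y] only [rho], so that [u_11] may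
    exceed [m_22] and [u_22] by [th ^+ 2]. The shift of the majorants by 2 gives second derivatives
    exactly the weight that is stable under products, while lower derivatives fit at the cost of a
    constant. *)

Section Series.
Variable R : realType.
Implicit Types (u v : nat -> R) (K q : R).

Definition ssum u : R := limn (series u).

Definition geometric_bound K q u := forall n, `|u n| <= K * q ^+ n.

Lemma geometric_bound_ge0 K q u : geometric_bound K q u -> 0 <= K.
Proof. by move=> /(_ 0%N); rewrite expr0 mulr1; apply: le_trans. Qed.

(** For [q <= 1/2] each [q ^+ n] is at most [2 * (q ^+ n - q ^+ n.+1)], so the bound telescopes. *)
Lemma series_tail_le K q u N p : 0 <= q <= 2^-1 -> geometric_bound K q u ->
  `|series u (N + p)%N - series u N| <= 2 * K * (q ^+ N - q ^+ (N + p)).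
Proof.
move=> /andP[q0 q2] gu; have K0 := geometric_bound_ge0 gu.
elim: p => [|p IH]; first by rewrite addn0 !subrr normr0 mulr0.
rewrite addnS seriesSr /= [_ + u _ - _]addrAC.
apply: le_trans (ler_normD _ _) _; apply: le_trans (lerD IH (gu _)) _.
rewrite exprS -subr_ge0.
set a := q ^+ (N + p); have a0 : 0 <= a by rewrite exprn_ge0.
have -> : 2 * K * (q ^+ N - q * a) - (2 * K * (q ^+ N - a) + K * a)
   = K * a * (1 - 2 * q) by ring.
by rewrite !mulr_ge0//; lra.
Qed.

Lemma geometric_bound_cvg K q u : 0 <= q <= 2^-1 -> geometric_bound K q u ->
  cvgn (series u).
Proof.
move=> /andP[q0 q2] gu; have K0 := geometric_bound_ge0 gu.
apply: normed_cvg; apply: (@series_le_cvg _ _ (geometric K q)) => //=.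
- by move=> n; rewrite /geometric /= mulr_ge0// exprn_ge0.
- by apply: is_cvg_geometric_series; rewrite ger0_norm//; lra.
Qed.

Lemma ssum_cvg K q u : 0 <= q <= 2^-1 -> geometric_bound K q u ->
  series u @ \oo --> ssum u.
Proof. by move=> q2 /(geometric_bound_cvg q2). Qed.

Lemma cvg_le_near u (l b : R) N : u @ \oo --> l ->
  (forall n, (N <= n)%N -> `|u n| <= b) -> `|l| <= b.
Proof.
move=> ul ub; have nl : `|u x| @[x --> \oo] --> `|l| by exact: cvg_norm.
rewrite -(cvg_lim (@Rhausdorff R) nl); apply: limr_le.
  by apply/cvg_ex; exists `|l|.
by exists N => // n /=; exact: ub.
Qed.

Lemma ssum_tail_le K q u N : 0 <= q <= 2^-1 -> geometric_bound K q u ->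
  `|ssum u - series u N| <= 2 * K * q ^+ N.
Proof.
move=> q2 gu; have K0 := geometric_bound_ge0 gu.
apply: (@cvg_le_near (fun n => series u n - series u N) _ _ N).
  by apply: cvgB; [exact: ssum_cvg q2 gu|exact: cvg_cst].
move=> n Nn; rewrite -(subnKC Nn).
apply: le_trans (series_tail_le _ _ q2 gu) _.
case/andP: q2 => q0 q2.
by rewrite ler_wpM2l ?mulr_ge0// gerBl exprn_ge0.
Qed.

Lemma ssum_le K q u : 0 <= q <= 2^-1 -> geometric_bound K q u ->
  `|ssum u| <= 2 * K.
Proof.
move=> q2 gu; have := ssum_tail_le 0 q2 gu.
by rewrite /series /= big_geq// subr0 expr0 mulr1.
Qed.

Lemma ssumE u l : series u @ \oo --> l -> ssum u = l.
Proof. exact: (cvg_lim (@Rhausdorff R)). Qed.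

Lemma eq_ssum u v : u =1 v -> ssum u = ssum v.
Proof. by move=> /funext ->. Qed.

Lemma ssumD K K' q u v : 0 <= q <= 2^-1 -> geometric_bound K q u ->
  geometric_bound K' q v -> ssum (fun n => u n + v n) = ssum u + ssum v.
Proof.
move=> q2 gu gv; apply: ssumE.
have -> : (fun n => u n + v n) = u + v by apply/funext.
by rewrite seriesD; apply: cvgD; [exact: ssum_cvg q2 gu|exact: ssum_cvg q2 gv].
Qed.

Lemma ssumZ K q u c : 0 <= q <= 2^-1 -> geometric_bound K q u ->
  ssum (fun n => c * u n) = c * ssum u.
Proof.
move=> q2 gu; apply: ssumE.
have -> : (fun n => c * u n) = c *: u by apply/funext.
by rewrite seriesZ; apply: cvgZr; exact: ssum_cvg q2 gu.
Qed.

Lemma geometric_bound_sum K q n (f : nat -> nat -> R) :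
  (forall k, (k < n)%N -> geometric_bound K q (f k)) ->
  geometric_bound (n%:R * K) q (fun m => \sum_(k < n) f k m).
Proof.
move=> gf m; apply: le_trans (ler_norm_sum _ _ _) _.
apply: (@le_trans _ _ (\sum_(k < n) K * q ^+ m)).
  by apply: ler_sum => k _; exact: gf.
by rewrite sumr_const card_ord -mulrA mulr_natl.
Qed.

Lemma ssum_sum K q n (f : nat -> nat -> R) : 0 <= q <= 2^-1 ->
  (forall k, (k < n)%N -> geometric_bound K q (f k)) ->
  ssum (fun m => \sum_(k < n) f k m) = \sum_(k < n) ssum (f k).
Proof.
move=> q2; elim: n => [|n IH] gf.
  rewrite big_ord0; apply: ssumE; rewrite /series /=.
  under eq_fun do [rewrite big1; last by move=> k _; rewrite big_ord0].
  exact: cvg_cst.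
have gf' k : (k < n)%N -> geometric_bound K q (f k) by move=> /ltnW; exact: gf.
rewrite big_ord_recr /= -IH//.
rewrite -(ssumD q2 (geometric_bound_sum gf') (gf n (ltnSn n))).
by apply: eq_ssum => m; rewrite big_ord_recr.
Qed.

Lemma big_triangle (a : nat -> nat -> R) N :
  \sum_(d < N) \sum_(i < d.+1) a i (d - i)%N
  = \sum_(i < N) \sum_(j < N - i) a i j.
Proof.
elim: N => [|N IH]; first by rewrite !big_ord0.
rewrite !big_ord_recr /= {}IH subnn subSnn big_ord1 addrA.
congr (_ + _); rewrite -big_split /=; apply: eq_bigr => i _.
by rewrite subSn 1?ltnW// big_ord_recr.
Qed.

Definition geometric_bound2 K q (a : nat -> nat -> R) :=
  forall i j, `|a i j| <= K * q ^+ (i + j).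

Lemma geometric_bound2_row K q a i : geometric_bound2 K q a ->
  geometric_bound (K * q ^+ i) q (a i).
Proof. by move=> ga j; rewrite -mulrA -exprD. Qed.

Lemma geometric_bound2_ssum K q a : 0 <= q <= 2^-1 -> geometric_bound2 K q a ->
  geometric_bound (2 * K) q (fun i => ssum (a i)).
Proof.
move=> q2 ga i; apply: le_trans (ssum_le q2 (@geometric_bound2_row K q a i ga)) _.
by rewrite mulrA.
Qed.

Lemma geometric_bound2_tr K q a : geometric_bound2 K q a ->
  geometric_bound2 K q (fun i j => a j i).
Proof. by move=> ga i j; rewrite addnC. Qed.

Definition diag (a : nat -> nat -> R) d := \sum_(i < d.+1) a i (d - i)%N.

(** The first [N] diagonals omit from row [i] the tail that starts at [N - i], which is at most
    [2 K 4^-N] whatever the row. The [N] rows together omit at most [2 K N 4^-N <= 2 K 2^-N]. *)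
Lemma diag_cvg K a : geometric_bound2 K 4^-1 a ->
  series (diag a) @ \oo --> ssum (fun i => ssum (a i)).
Proof.
move=> ga; have q2 : 0 <= (4^-1 : R) <= 2^-1 by lra.
have gr := geometric_bound2_ssum q2 ga; have K0 := geometric_bound_ge0 gr.
set r := (fun i => ssum (a i)) in gr *.
have -> : series (diag a) = (fun N => series r N - (series r N - series (diag a) N)).
  by apply/funext => N; rewrite subKr.
rewrite -[X in _ --> X]subr0; apply: cvgB; first exact: ssum_cvg q2 gr.
apply: norm_cvg0.
apply: (@squeeze_cvgr _ \oo _ R (cst 0) (fun N => 2 * K * 2^-1 ^+ N)).
- near=> N; rewrite normr_ge0 /=.
  rewrite /series /= /diag !big_mkord big_triangle -sumrB.
  apply: le_trans (ler_norm_sum _ _ _) _.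
  apply: (@le_trans _ _ (\sum_(i < N) 2 * K * 4^-1 ^+ N)).
    apply: ler_sum => i _.
    have := ssum_tail_le (N - i) q2 (@geometric_bound2_row _ _ _ i ga).
    rewrite /series /= big_mkord => /le_trans; apply.
    by rewrite -!mulrA -exprD subnKC// ltnW.
  rewrite sumr_const card_ord -[X in X <= _]mulr_natr -mulrA ler_wpM2l//.
  have -> : 4^-1 = 2^-1 * 2^-1 :> R by field.
  rewrite exprMn -mulrA ler_piMr ?exprn_ge0// exprVn mulrC ler_pdivrMr ?exprn_gt0//.
  by rewrite mul1r -natrX ler_nat ltnW// ltn_expl.
- exact: cvg_cst.
- rewrite -[X in _ --> X](mulr0 (2 * K)); apply: cvgMr; apply: cvg_expr.
  by rewrite ger0_norm//; lra.
Unshelve. all: by end_near.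
Qed.

(** Both iterated sums are limits of diagonal sums, and transposing the array only reverses each
    diagonal. *)
Lemma ssum_exchange K a : geometric_bound2 K 4^-1 a ->
  ssum (fun i => ssum (a i)) = ssum (fun j => ssum (fun i => a i j)).
Proof.
move=> ga; rewrite -(ssumE (diag_cvg ga)).
rewrite -(ssumE (diag_cvg (geometric_bound2_tr ga))).
apply: eq_ssum => d; rewrite /diag [LHS](reindex_inj rev_ord_inj) /=.
by apply: eq_bigr => i _; rewrite subSS subKn// -ltnS.
Qed.

Lemma ssum_conv K K' u v : geometric_bound K 4^-1 u -> geometric_bound K' 4^-1 v ->
  ssum (diag (fun i j => u i * v j)) = ssum u * ssum v.
Proof.
move=> gu gv; have q2 : 0 <= (4^-1 : R) <= 2^-1 by lra.
have ga : geometric_bound2 (K * K') 4^-1 (fun i j => u i * v j).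
  move=> i j; rewrite normrM exprD mulrACA; exact: ler_pM.
rewrite (ssumE (diag_cvg ga)).
under eq_ssum do rewrite (ssumZ _ q2 gv) mulrC.
by rewrite (ssumZ _ q2 gu) mulrC.
Qed.

End Series.

(** * Double power series: products, transposition, re-expansion at another point *)

Section DoubleSeries.
Variable R : realType.
Implicit Types (a b c : nat -> nat -> R) (f g : R -> R -> R) (K B q r x y : R).

Definition eval2 c x y := ssum (fun i => ssum (fun j => c i j * x ^+ i * y ^+ j)).

Definition conv2 a b i j := diag (fun k k' => diag (fun l l' => a k l * b k' l') j) i.

Definition tr2 c i j := c j i.

(** The coefficient of [k ^+ l] when row [i], as a power series in [t], is re-expanded at
    [t = y + k]. *)
Definition shift2 y c i l := ssum (fun p => c i (l + p)%N * 'C(l + p, l)%:R * y ^+ p).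

Definition D1 c i j := i.+1%:R * c i.+1 j.
Definition D2 c i j := j.+1%:R * c i j.+1.

Lemma geometric_bound2_ge0 K q c : geometric_bound2 K q c -> 0 <= K.
Proof. by move=> /(_ 0%N 0%N); rewrite mulr1; apply: le_trans. Qed.

Lemma terms_bound K B q c x y : geometric_bound2 K B c ->
  0 <= B -> B * `|x| <= q -> B * `|y| <= q ->
  geometric_bound2 K q (fun i j => c i j * x ^+ i * y ^+ j).
Proof.
move=> gc B0 xq yq i j; rewrite !normrM !normrX.
have K0 := geometric_bound2_ge0 gc.
apply: (@le_trans _ _ (K * (B * `|x|) ^+ i * (B * `|y|) ^+ j)).
  rewrite !exprMn [leRHS](_ : _ = K * B ^+ (i + j) * `|x| ^+ i * `|y| ^+ j).
    by rewrite !ler_wpM2r ?exprn_ge0//.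
  by rewrite exprD; ring.
rewrite exprD -mulrA ler_wpM2l//; apply: ler_pM; rewrite ?exprn_ge0 ?mulr_ge0//.
  by apply: lerXn2r => //; rewrite nnegrE ?mulr_ge0//; apply: le_trans xq; rewrite
    mulr_ge0.
by apply: lerXn2r => //; rewrite nnegrE ?mulr_ge0//; apply: le_trans yq; rewrite mulr_ge0.
Qed.

Lemma diag_bound K q a : 0 <= q -> geometric_bound2 K q a ->
  geometric_bound K (2 * q) (diag a).
Proof.
move=> q0 ga n; apply: le_trans (ler_norm_sum _ _ _) _.
have K0 := geometric_bound2_ge0 ga.
apply: (@le_trans _ _ (\sum_(k < n.+1) K * q ^+ n)).
  by apply: ler_sum => i _; apply: le_trans (ga _ _) _; rewrite subnKC// -ltnS.
rewrite sumr_const card_ord -[leLHS]mulr_natr -mulrA ler_wpM2l// exprMn mulrC.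
by rewrite ler_wpM2r ?exprn_ge0// -natrX ler_nat ltn_expl.
Qed.

Lemma conv2_bound K K' B a b : 0 <= B ->
  geometric_bound2 K B a -> geometric_bound2 K' B b ->
  geometric_bound2 (K * K') (2 * B) (conv2 a b).
Proof.
move=> B0 ga gb i j; rewrite exprD mulrA [_ * _ ^+ i * _]mulrAC.
apply: (@diag_bound _ B) => // k k'.
rewrite -[leRHS]mulrA [_ * B ^+ _]mulrC mulrA.
apply: (@diag_bound _ B) => // l l'; rewrite normrM.
apply: le_trans (ler_pM _ _ (ga _ _) (gb _ _)) _ => //.
by rewrite !exprD le_eqVlt; apply/orP; left; apply/eqP; ring.
Qed.

Lemma eval2_conv2 K K' B a b x y : 0 <= B ->
  geometric_bound2 K B a -> geometric_bound2 K' B b ->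
  B * `|x| <= 4^-1 -> B * `|y| <= 4^-1 ->
  eval2 (conv2 a b) x y = eval2 a x y * eval2 b x y.
Proof.
move=> B0 ga gb xB yB.
have q4 : 0 <= (4^-1 : R) <= 2^-1 by lra.
have ta := terms_bound ga B0 xB yB; have tb := terms_bound gb B0 xB yB.
set e := (fun i j => _) in ta; set e' := (fun i j => _) in tb.
have -> : eval2 (conv2 a b) x y = ssum (fun i => ssum (fun j =>
    \sum_(k < i.+1) diag (fun l l' => e k l * e' (i - k)%N l') j)).
  apply: eq_ssum => i; apply: eq_ssum => j.
  rewrite /conv2 /diag -mulrA mulr_suml; apply: eq_bigr => k _.
  rewrite mulr_suml; apply: eq_bigr => l _; rewrite /e /e'.
  have -> : x ^+ i = x ^+ k * x ^+ (i - k) by rewrite -exprD subnKC// -ltnS.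
  have -> : y ^+ j = y ^+ l * y ^+ (j - l) by rewrite -exprD subnKC// -ltnS.
  ring.
rewrite /eval2 -(ssum_conv (geometric_bound2_ssum q4 ta) (geometric_bound2_ssum q4 tb)).
apply: eq_ssum => i.
(* A Cauchy product of ratio 1/4 has ratio 1/2, the largest that [ssum_sum] admits; hence the bound
   [4^-1] in the hypotheses. *)
have gf k : (k < i.+1)%N -> geometric_bound (K * K') (2 * 4^-1)
    (diag (fun l l' => e k l * e' (i - k)%N l')).
  move=> ki; apply: diag_bound => [|l l']; first by lra.
  rewrite normrM; apply: le_trans (ler_pM _ _ (ta _ _) (tb _ _)) _ => //.
  rewrite mulrACA -exprD ler_wpM2l//.
    by rewrite mulr_ge0// (geometric_bound2_ge0 ta, geometric_bound2_ge0 tb).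
  rewrite addnACA exprD ler_piMl ?exprn_ge0 ?exprn_ile1//; lra.
rewrite (ssum_sum _ gf); last by lra.
apply: eq_bigr => k _.
by rewrite (ssum_conv (@geometric_bound2_row _ _ _ _ k ta)
  (@geometric_bound2_row _ _ _ _ (i - k)%N tb)).
Qed.

Lemma eval2_tr K B c x y : 0 <= B -> geometric_bound2 K B c ->
  B * `|x| <= 4^-1 -> B * `|y| <= 4^-1 -> eval2 (tr2 c) y x = eval2 c x y.
Proof.
move=> B0 gc xB yB; rewrite /eval2 (ssum_exchange (terms_bound gc B0 xB yB)).
by apply: eq_ssum => j; apply: eq_ssum => i; rewrite /tr2 mulrAC.
Qed.

Lemma shift_row_bound K B c y i l : 0 <= B -> geometric_bound2 K B c ->
  8 * B * `|y| <= 1 ->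
  geometric_bound (K * B ^+ i * (2 * B) ^+ l) 4^-1
    (fun p => c i (l + p)%N * 'C(l + p, l)%:R * y ^+ p).
Proof.
move=> B0 gc yB p; rewrite !normrM !normrX normr_nat.
have K0 := geometric_bound2_ge0 gc.
have C2 : ('C(l + p, l)%:R : R) <= 2 ^+ (l + p).
  rewrite -natrX ler_nat -[2%N]/(1 + 1)%N (Pascal 1 1).
  rewrite (bigD1 (Ordinal (leq_addr p l : (l < (l + p).+1)%N)))//= !exp1n !muln1.
  exact: leq_addr.
apply: (@le_trans _ _ (K * B ^+ (i + (l + p)) * 2 ^+ (l + p) * `|y| ^+ p)).
  rewrite ler_wpM2r ?exprn_ge0//; apply: ler_pM => //; exact: gc.
rewrite (_ : _ * _ = K * B ^+ i * (2 * B) ^+ l * (2 * B * `|y|) ^+ p); last first.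
  by rewrite !exprMn !exprD; ring.
rewrite ler_wpM2l ?mulr_ge0 ?exprn_ge0 ?mulr_ge0//.
by apply: lerXn2r; rewrite ?nnegrE ?mulr_ge0//; lra.
Qed.

Lemma shift2_bound K B c y : 0 <= B -> geometric_bound2 K B c ->
  8 * B * `|y| <= 1 -> geometric_bound2 (2 * K) (2 * B) (shift2 y c).
Proof.
move=> B0 gc yB i l; have q4 : 0 <= (4^-1 : R) <= 2^-1 by lra.
have K0 := geometric_bound2_ge0 gc.
apply: le_trans (ssum_le q4 (shift_row_bound i l B0 gc yB)) _.
rewrite [(2 * B) ^+ (i + l)]exprD !mulrA ler_wpM2r ?exprn_ge0 ?mulr_ge0//.
rewrite ler_wpM2l ?mulr_ge0// exprMn ler_peMl ?exprn_ge0//.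
by rewrite exprn_ege1//; lra.
Qed.

(** By the binomial theorem row [i] is the series of diagonals of the array [b] below, so [diag_cvg]
    regroups it. The binomial coefficients double the ratio; the factor 8 leaves 1/4 in both
    directions of [b]. *)
Lemma eval2_shift2 K B c x y k : 0 <= B -> geometric_bound2 K B c ->
  8 * B * `|y| <= 1 -> 8 * B * `|k| <= 1 ->
  eval2 c x (y + k) = eval2 (shift2 y c) x k.
Proof.
move=> B0 gc yB kB; have q4 : 0 <= (4^-1 : R) <= 2^-1 by lra.
have K0 := geometric_bound2_ge0 gc.
apply: eq_ssum => i.
pose b l p := x ^+ i * k ^+ l * (c i (l + p)%N * 'C(l + p, l)%:R * y ^+ p).
have gb : geometric_bound2 (`|x| ^+ i * (K * B ^+ i)) 4^-1 b.
  move=> l p; rewrite normrM.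
  apply: le_trans (ler_wpM2l (normr_ge0 _) (shift_row_bound i l B0 gc yB p)) _.
  rewrite normrM !normrX exprD.
  rewrite [leLHS](_ : _ = `|x| ^+ i * (K * B ^+ i) * 4^-1 ^+ p * (2 * B * `|k|) ^+ l).
    rewrite [leRHS](_ : _ = `|x| ^+ i * (K * B ^+ i) * 4^-1 ^+ p * 4^-1 ^+ l).
      rewrite ler_wpM2l ?mulr_ge0 ?exprn_ge0//; try lra.
      by apply: lerXn2r; rewrite ?nnegrE ?mulr_ge0//; lra.
    by ring.
  by rewrite !exprMn; ring.
transitivity (ssum (diag b)).
  apply: eq_ssum => j; rewrite exprDn mulr_sumr; apply: eq_bigr => l _.
  have ld : (l <= j)%N by rewrite -ltnS.
  rewrite /b subnKC// -mulr_natr; ring.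
rewrite (ssumE (diag_cvg gb)); apply: eq_ssum => l.
rewrite /b (ssumZ _ q4 (shift_row_bound i l B0 gc yB)) /shift2; ring.
Qed.

Definition recenter x y c := tr2 (shift2 x (tr2 (shift2 y c))).

Lemma tr2_bound K B c : geometric_bound2 K B c -> geometric_bound2 K B (tr2 c).
Proof. exact: geometric_bound2_tr. Qed.

Lemma recenter_bound K B c x y : 0 <= B -> geometric_bound2 K B c ->
  16 * B * `|x| <= 1 -> 16 * B * `|y| <= 1 ->
  geometric_bound2 (4 * K) (4 * B) (recenter x y c).
Proof.
move=> B0 gc xB yB.
have -> : 4 * K = 2 * (2 * K) by ring.
have -> : 4 * B = 2 * (2 * B) by ring.
apply/tr2_bound/shift2_bound; [by lra| |by lra].
apply/tr2_bound/shift2_bound => //.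
by have := normr_ge0 y; nra.
Qed.

Lemma eval2_recenter K B c x y h k : 0 <= B -> geometric_bound2 K B c ->
  32 * B * `|x| <= 1 -> 32 * B * `|y| <= 1 ->
  32 * B * `|h| <= 1 -> 32 * B * `|k| <= 1 ->
  eval2 c (x + h) (y + k) = eval2 (recenter x y c) h k.
Proof.
move=> B0 gc xB yB hB kB.
have le0 (z : R) : 0 <= B * `|z| by rewrite mulr_ge0.
have nx := le0 x; have ny := le0 y; have nh := le0 h; have nk := le0 k.
have xh : B * `|x + h| <= 16^-1.
  by apply: le_trans (ler_wpM2l B0 (ler_normD _ _)) _; rewrite mulrDr; lra.
have yB' : 8 * B * `|y| <= 1 by lra.
rewrite (eval2_shift2 _ B0 gc); [|lra|lra].
have g1 := shift2_bound B0 gc yB'.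
rewrite -(eval2_tr _ g1); [|lra|lra|lra].
rewrite (eval2_shift2 _ _ (tr2_bound g1)); [|lra|lra|lra].
by rewrite -(eval2_tr _ (shift2_bound _ (tr2_bound g1) _)) //; lra.
Qed.

(** The tail from order two is at most [2 K (B |h|)^2], so the difference quotient is within
    [2 K B^2 |h|] of [b 1]. *)
Lemma is_derive_ssum (f : R -> R) x K B (b : nat -> R) r : 0 < r -> 0 <= B ->
  geometric_bound K B b ->
  (forall h, `|h| < r -> f (x + h) = ssum (fun i => b i * h ^+ i)) ->
  is_derive x 1 f (b 1%N).
Proof.
move=> r0 B0 gb fE.
suff lim : (fun h => h^-1 *: ((f \o shift x) (h *: (1 : R)) - f x)) @ 0^' --> b 1%N.
  by apply: DeriveDef; [apply/cvg_ex; exists (b 1%N)|exact: cvg_lim].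
have K0 := geometric_bound_ge0 gb.
have tail h : `|h| < r -> B * `|h| <= 2^-1 ->
    `|f (x + h) - (b 0%N + b 1%N * h)| <= 2 * K * (B * `|h|) ^+ 2.
  move=> hr hB; have q2 : 0 <= B * `|h| <= 2^-1 by rewrite mulr_ge0.
  have gh : geometric_bound K (B * `|h|) (fun i => b i * h ^+ i).
    by move=> i; rewrite normrM normrX exprMn mulrA ler_wpM2r ?exprn_ge0.
  have := ssum_tail_le 2 q2 gh; rewrite fE//.
  by rewrite /series /= big_mkord !big_ord_recr big_ord0 /= add0r expr0 mulr1.
have f0 : f x = b 0%N.
  have := tail 0; rewrite normr0 addr0 !mulr0 addr0 expr0n /= mulr0 => /(_ r0 _).
  by rewrite normr_le0 subr_eq0 => t; apply/eqP/t.
apply/cvgrPdist_le => e e0; near=> h.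
have h0 : h != 0 by near: h; exact: nbhs_dnbhs_neq.
have hr : `|h| < r by near: h; exact: dnbhs0_lt.
have hB : B * `|h| <= 2^-1.
  have : `|h| < (2 * B + 1)^-1 by near: h; apply: dnbhs0_lt; rewrite invr_gt0; lra.
  by rewrite -[X in _ < X]mul1r ltr_pdivlMr; [nra|lra].
have he : 2 * K * B ^+ 2 * `|h| <= e.
  have : `|h| < e / (2 * K * B ^+ 2 + 1).
    by near: h; apply: dnbhs0_lt; rewrite divr_gt0// ltr_wpDl// !mulr_ge0// exprn_ge0.
  rewrite ltr_pdivlMr; last by rewrite ltr_wpDl// !mulr_ge0// exprn_ge0.
  by have := normr_ge0 h; nra.
rewrite -(ler_pM2l (_ : 0 < `|h|)) ?normr_gt0//.
apply: le_trans (_ : _ <= 2 * K * (B * `|h|) ^+ 2) _; last first.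
  have -> : 2 * K * (B * `|h|) ^+ 2 = `|h| * (2 * K * B ^+ 2 * `|h|) by ring.
  by rewrite ler_wpM2l.
rewrite -normrM (le_trans _ (tail _ hr hB))//.
rewrite -normrN f0 /GRing.scale /= mulr1 [h + x]addrC mulrBr mulrA divff// mul1r.
by rewrite le_eqVlt; apply/orP; left; apply/eqP; congr `|_|; ring.
Unshelve. all: by end_near.
Qed.

End DoubleSeries.

(** * Functions represented near a point by a coefficient array *)

Section Represents.
Variable R : realType.
Implicit Types (a b c : nat -> nat -> R) (f g : R -> R -> R) (K B q r x y : R).

(** The differences are oriented as in the ball of the product, whose membership unfolds to these
    two inequalities. *)
Definition near_point (x0 y0 : R) (P : R -> R -> Prop) :=
  exists2 r : R, 0 < r & forall x y, `|x0 - x| < r -> `|y0 - y| < r -> P x y.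

Lemma near_point_of_shift x0 y0 (P : R -> R -> Prop) :
  (exists2 r : R, 0 < r & forall h k : R, `|h| < r -> `|k| < r -> P (x0 + h) (y0 + k)) ->
  near_point x0 y0 P.
Proof.
move=> [r r0 E]; exists r => // x y xr yr.
have -> : x = x0 + (x - x0) by ring.
have -> : y = y0 + (y - y0) by ring.
by apply: E; rewrite distrC.
Qed.

Lemma near_point_and x0 y0 (P Q : R -> R -> Prop) : near_point x0 y0 P ->
  near_point x0 y0 Q -> near_point x0 y0 (fun x y => P x y /\ Q x y).
Proof.
move=> [r r0 E] [s s0 F]; exists (Num.min r s); first by rewrite lt_min r0.
by move=> x y; rewrite !lt_min => /andP[? ?] /andP[? ?]; split; [exact: E|exact: F].
Qed.

Definition add2 a b i j := a i j + b i j.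

(** Nothing ties [r] to [B]: where the series diverges, the equation compares [f] with a meaningless
    value of [limn]. [represents2] shrinks [r] before any use of convergence. *)
Definition represents x0 y0 c f := exists K B r,
  [/\ 0 < B, 0 < r, geometric_bound2 K B c &
      forall h k, `|h| < r -> `|k| < r -> f (x0 + h) (y0 + k) = eval2 c h k].

Lemma geometric_bound2_weaken K K' B B' c : K <= K' -> 0 <= B <= B' ->
  geometric_bound2 K B c -> geometric_bound2 K' B' c.
Proof.
move=> KK' /andP[B0 BB'] gc i j; apply: le_trans (gc i j) _.
have K0 := geometric_bound2_ge0 gc.
apply: ler_pM; rewrite ?exprn_ge0//.
by apply: lerXn2r => //; rewrite nnegrE//; apply: le_trans BB'.
Qed.

(* Two representations may be put at a common scale, with the evaluation points
   as deep inside the domain of convergence as needed. *)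
Lemma represents2 x0 y0 a b f g (M : R) : 0 < M ->
  represents x0 y0 a f -> represents x0 y0 b g ->
  exists K B r, [/\ 0 < B /\ 0 < r, M * B * r <= 1,
    geometric_bound2 K B a, geometric_bound2 K B b &
    forall h k, `|h| < r -> `|k| < r ->
      f (x0 + h) (y0 + k) = eval2 a h k /\ g (x0 + h) (y0 + k) = eval2 b h k].
Proof.
move=> M0 [K [B [r [B0 r0 ga fE]]]] [K' [B' [r' [B'0 r'0 gb gE]]]].
exists (Num.max K K'), (Num.max B B'), (Num.min (Num.min r r') (M * Num.max B B')^-1).
have m0 : 0 < Num.max B B' by rewrite lt_max B0.
split=> //.
- by split; rewrite // !lt_min r0 r'0 /= invr_gt0 mulr_gt0.
- rewrite -(divff (_ : M * Num.max B B' != 0)) ?gt_eqF ?mulr_gt0//.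
  by rewrite ler_pM2l ?mulr_gt0// ge_min lexx orbT.
- by apply: geometric_bound2_weaken ga; rewrite le_max lexx//= (ltW B0).
- by apply: geometric_bound2_weaken gb; rewrite le_max lexx orbT// (ltW B'0).
- by move=> h k; rewrite !lt_min => /andP[/andP[? ?] _] /andP[/andP[? ?] _]; split;
  [exact: fE|exact: gE].
Qed.

Lemma eval2D K B a b x y : 0 <= B -> geometric_bound2 K B a ->
  geometric_bound2 K B b -> B * `|x| <= 4^-1 -> B * `|y| <= 4^-1 ->
  eval2 (add2 a b) x y = eval2 a x y + eval2 b x y.
Proof.
move=> B0 ga gb xB yB; have q4 : 0 <= (4^-1 : R) <= 2^-1 by lra.
have ta := terms_bound ga B0 xB yB; have tb := terms_bound gb B0 xB yB.
rewrite /eval2 -(ssumD q4 (geometric_bound2_ssum q4 ta) (geometric_bound2_ssum q4 tb)).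
apply: eq_ssum => i; rewrite -(ssumD q4 (@geometric_bound2_row _ _ _ _ i ta)
  (@geometric_bound2_row _ _ _ _ i tb)).
by apply: eq_ssum => j; rewrite !mulrDl.
Qed.

Lemma ball_bound (M B r h : R) : 0 < B -> M * B * r <= 1 -> 0 < M -> `|h| < r -> M * (B
  * `|h|) <= 1.
Proof.
move=> B0 Mr M0 hr; apply: le_trans Mr; rewrite -mulrA ler_pM2l// ler_pM2l//.
exact: ltW.
Qed.

Lemma representsD x0 y0 a b f g : represents x0 y0 a f -> represents x0 y0 b g ->
  represents x0 y0 (add2 a b) (fun x y => f x y + g x y).
Proof.
move=> ra rb; have [K [B [r [[B0 r0] Br ga gb E]]]] := represents2 (ltr0n R 4) ra rb.
exists (K + K), B, r; split=> // [i j|h k hr kr].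
  by rewrite mulrDl; apply: le_trans (ler_normD _ _) (lerD (ga _ _) (gb _ _)).
have [-> ->] := E _ _ hr kr; rewrite (eval2D _ ga gb)//; first exact: ltW.
  by have := ball_bound B0 Br (ltr0n R 4) hr; lra.
by have := ball_bound B0 Br (ltr0n R 4) kr; lra.
Qed.

Lemma representsM x0 y0 a b f g : represents x0 y0 a f -> represents x0 y0 b g ->
  represents x0 y0 (conv2 a b) (fun x y => f x y * g x y).
Proof.
move=> ra rb; have [K [B [r [[B0 r0] Br ga gb E]]]] := represents2 (ltr0n R 4) ra rb.
exists (K * K), (2 * B), r; split=> //; first by rewrite mulr_gt0.
  by apply: conv2_bound => //; exact: ltW.
move=> h k hr kr; have [-> ->] := E _ _ hr kr.
rewrite (eval2_conv2 _ ga gb)//; first exact: ltW.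
  by have := ball_bound B0 Br (ltr0n R 4) hr; lra.
by have := ball_bound B0 Br (ltr0n R 4) kr; lra.
Qed.

(** The passage from coefficient recursions to differential equations: both sides of an equation are
    represented by one array. *)
Lemma representsE x0 y0 c f g : represents x0 y0 c f -> represents x0 y0 c g ->
  near_point x0 y0 (fun x y => f x y = g x y).
Proof.
move=> ra rb; have [K [B [r [[B0 r0] Br ga gb E]]]] := represents2 (ltr0n R 4) ra rb.
by apply: near_point_of_shift; exists r => // h k hr kr; have [-> ->] := E _ _ hr kr.
Qed.

Definition const2 (z : R) i j := if (i == 0%N) && (j == 0%N) then z else 0.

Lemma ssum_single (u : nat -> R) : (forall n, (0 < n)%N -> u n = 0) -> ssum u = u 0%N.
Proof.
move=> u0; apply: ssumE; rewrite -(cvg_shiftn 1) /=.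
under eq_fun do [rewrite addn1 /series /= big_mkord big_ord_recl /= big1;
  last by move=> i _; rewrite u0].
rewrite addr0; exact: cvg_cst.
Qed.

Lemma eval2_const z x y : eval2 (const2 z) x y = z.
Proof.
rewrite /eval2 ssum_single => [|i i0]; last first.
  by rewrite ssum_single => [|j _]; rewrite /const2 gtn_eqF//= !mul0r.
rewrite ssum_single => [|j j0]; first by rewrite !expr0 !mulr1.
by rewrite /const2 /= gtn_eqF// !mul0r.
Qed.

Lemma represents_const x0 y0 z : represents x0 y0 (const2 z) (fun _ _ => z).
Proof.
exists `|z|, 1, 1; split=> // [i j|h k _ _]; last by rewrite eval2_const.
by rewrite expr1n mulr1 /const2; case: ifP; rewrite ?normr0.
Qed.

Lemma represents_tr x0 y0 c f : represents x0 y0 c f ->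
  represents y0 x0 (tr2 c) (fun x y => f y x).
Proof.
move=> rc; have [K [B [r [[B0 r0] Br gc _ E]]]] := represents2 (ltr0n R 4) rc rc.
exists K, B, r; split=> //; first exact: tr2_bound.
move=> h k hr kr; have [-> _] := E _ _ kr hr.
rewrite (eval2_tr _ gc)//; first exact: ltW.
  by have := ball_bound B0 Br (ltr0n R 4) kr; lra.
by have := ball_bound B0 Br (ltr0n R 4) hr; lra.
Qed.

Lemma D1_bound K B c : 0 <= B -> geometric_bound2 K B c ->
  geometric_bound2 (K * B) (2 * B) (D1 c).
Proof.
move=> B0 gc i j; rewrite /D1 normrM normr_nat.
have K0 := geometric_bound2_ge0 gc.
apply: le_trans (ler_wpM2l (ler0n _ _) (gc _ _)) _.
rewrite [leLHS](_ : _ = K * B * B ^+ (i + j) * i.+1%:R); last by rewrite addSn exprS;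
  ring.
rewrite [leRHS](_ : _ = K * B * B ^+ (i + j) * 2 ^+ (i + j)); last by rewrite exprMn;
  ring.
rewrite ler_wpM2l ?mulr_ge0 ?exprn_ge0//.
rewrite -natrX ler_nat; apply: leq_trans (ltn_expl _ (ltnSn 1)) _.
by rewrite leq_exp2l// leq_addr.
Qed.

(** Re-expanding the first variable at [h] makes the derivative at [x0 + h] a linear coefficient.
    Since ['C(1 + p, 1) = p + 1], that coefficient is the value of [D1 c] at [(h, k)]. *)
Lemma represents_is_derive1 x0 y0 c f : represents x0 y0 c f ->
  exists K B r, [/\ 0 < B, 0 < r, geometric_bound2 K B (D1 c) &
    forall h k, `|h| < r -> `|k| < r ->
      is_derive (x0 + h) 1 (fun x => f x (y0 + k)) (eval2 (D1 c) h k)].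
Proof.
move=> rc; have [K [B [r [[B0 r0] Br gc _ E]]]] := represents2 (ltr0n R 64) rc rc.
have B0' := ltW B0.
exists (K * B), (2 * B), (r / 2); split=> //; rewrite ?mulr_gt0//; first exact: D1_bound.
move=> h k hr kr.
have ball (z : R) : `|z| < r -> 64 * (B * `|z|) <= 1 by move=> zr; exact: ball_bound B0
  Br (ltr0n R 64) zr.
have hr' : `|h| < r by lra.
have kr' : `|k| < r by lra.
have bh := ball _ hr'; have bk := ball _ kr'.
have B8h : 8 * B * `|h| <= 1 by have := mulr_ge0 B0' (normr_ge0 h); lra.
have gt := shift2_bound B0' (tr2_bound gc) B8h.
have g2 : geometric_bound2 (2 * K) (2 * B) (tr2 (shift2 h (tr2 c))) by exact: tr2_bound.
pose b i := ssum (fun j => tr2 (shift2 h (tr2 c)) i j * k ^+ j).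
have kB4 : 2 * B * `|k| <= 4^-1 by lra.
have B20 : 0 <= 2 * B by rewrite mulr_ge0.
have q4 : 0 <= (4^-1 : R) <= 2^-1 by lra.
have row i : geometric_bound (2 * K * (2 * B) ^+ i) 4^-1
    (fun j => tr2 (shift2 h (tr2 c)) i j * k ^+ j).
  move=> j; rewrite normrM normrX; apply: le_trans (ler_wpM2r (exprn_ge0 _ (normr_ge0
    _)) (g2 _ _)) _.
  rewrite exprD !mulrA -[_ * _ * `|k| ^+ j]mulrA -exprMn.
  rewrite ler_wpM2l ?mulr_ge0 ?exprn_ge0 ?(geometric_bound2_ge0 gc)//.
  by apply: lerXn2r => //; rewrite nnegrE ?mulr_ge0.
have gb : geometric_bound (2 * (2 * K)) (2 * B) b.
  by move=> i; apply: le_trans (ssum_le q4 (row i)) _; rewrite !mulrA.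
have -> : eval2 (D1 c) h k = b 1%N.
  rewrite -(eval2_tr B20 (D1_bound B0' gc) _ kB4); last by lra.
  rewrite /b; apply: eq_ssum => j; rewrite /tr2 /shift2 [RHS]mulrC.
  have q2 := shift_row_bound j 1 B0' (tr2_bound gc) B8h.
  rewrite -(ssumZ _ q4 q2); apply: eq_ssum => i.
  by rewrite add1n bin1 /tr2 /D1; ring.
apply: (is_derive_ssum (r := r / 2) (b := b) _ B20 gb); first by rewrite divr_gt0.
  move=> h' h'r; rewrite -addrA.
  have hh' : `|h + h'| < r by apply: le_lt_trans (ler_normD _ _) _; lra.
  have [-> _] := E _ _ hh' kr'.
  have bh' : 64 * (B * `|h'|) <= 1 by apply: ball; lra.
  have nn : B * `|h + h'| <= 4^-1.
    by apply: le_trans (ler_wpM2l B0' (ler_normD _ _)) _; rewrite mulrDr; lra.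
  rewrite -(eval2_tr B0' gc nn); last by lra.
  rewrite (eval2_shift2 _ B0' (tr2_bound gc) B8h); last by lra.
  rewrite -(eval2_tr B20 gt kB4); last by lra.
  apply: eq_ssum => i; rewrite /b mulrC -(ssumZ _ q4 (row i)).
  by apply: eq_ssum => j; ring.
Qed.

Lemma represents_d1 x0 y0 c f : represents x0 y0 c f -> represents x0 y0 (D1 c) (d1 f).
Proof.
move=> /represents_is_derive1[K [B [r [B0 r0 gc E]]]]; exists K, B, r; split=> // h k
  hr kr.
by have D := E _ _ hr kr; rewrite /d1 derive1E derive_val.
Qed.

Lemma represents_derivable1 x0 y0 c f : represents x0 y0 c f ->
  near_point x0 y0 (fun x y => is_derive x 1 (f^~ y) (d1 f x y)).
Proof.
move=> /represents_is_derive1[K [B [r [B0 r0 gc E]]]].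
apply: near_point_of_shift; exists r => // h k hr kr.
by have D := E _ _ hr kr; rewrite /d1 derive1E derive_val.
Qed.

Lemma represents_d2 x0 y0 c f : represents x0 y0 c f ->
  represents x0 y0 (D2 c) (d2 f).
Proof. by move=> /represents_tr /represents_d1 /represents_tr. Qed.

Lemma represents_derivable2 x0 y0 c f : represents x0 y0 c f ->
  near_point x0 y0 (fun x y => is_derive y 1 (f x) (d2 f x y)).
Proof.
move=> /represents_tr /represents_derivable1[r r0 E].
by exists r => // x y xr yr; exact: E.
Qed.

(** The expansion at a nearby point is the recentred array; its absolute convergence is [diag_cvg]
    for the array of absolute values. *)
Lemma represents_analytic x0 y0 c f : represents x0 y0 c f ->
  near_point x0 y0 (analytic_at f).
Proof.
move=> rc; have [K [B [r [[B0 r0] Br gc _ E]]]] := represents2 (ltr0n R 64) rc rc.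
have B0' := ltW B0.
apply: near_point_of_shift; exists (r / 2) => [|x y xr yr]; first by rewrite divr_gt0.
have ball (z : R) : `|z| < r -> 64 * (B * `|z|) <= 1 by move=> zr; exact: ball_bound B0
  Br (ltr0n R 64) zr.
have bx : 64 * (B * `|x|) <= 1 by apply: ball; lra.
have by_ : 64 * (B * `|y|) <= 1 by apply: ball; lra.
have nx := mulr_ge0 B0' (normr_ge0 x); have ny := mulr_ge0 B0' (normr_ge0 y).
have gr : geometric_bound2 (4 * K) (4 * B) (recenter x y c).
  by apply: recenter_bound => //; lra.
exists (recenter x y c), (r / 2); split=> [|h k hr kr]; first by rewrite divr_gt0.
have bh : 64 * (B * `|h|) <= 1 by apply: ball; lra.
have bk : 64 * (B * `|k|) <= 1 by apply: ball; lra.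
have B4 : 0 <= 4 * B by lra.
have hq : 4 * B * `|h| <= 4^-1 by lra.
have kq : 4 * B * `|k| <= 4^-1 by lra.
have t := terms_bound gr B4 hq kq.
split.
  have tn : geometric_bound2 (4 * K) 4^-1
      (fun i j => `|recenter x y c i j * h ^+ i * k ^+ j|).
    by move=> i j; rewrite normr_id.
  by have := diag_cvg tn => /cvgP.
have xh : `|x + h| < r by apply: le_lt_trans (ler_normD _ _) _; lra.
have yk : `|y + k| < r by apply: le_lt_trans (ler_normD _ _) _; lra.
rewrite -!addrA; have [-> _] := E _ _ xh yk.
by rewrite (eval2_recenter B0' gc); [exact: diag_cvg t|lra..].
Qed.

Lemma represents_center x0 y0 c f : represents x0 y0 c f -> f x0 y0 = c 0%N 0%N.
Proof.
move=> [K [B [r [B0 r0 gc E]]]].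
rewrite -[x0]addr0 -[y0]addr0 E ?normr0// /eval2.
have s j n : (0 < n)%N -> c j n * 0 ^+ j * 0 ^+ n = 0 by move=> n0; rewrite [0 ^+
  n]expr0n gtn_eqF// mulr0.
rewrite ssum_single => [|i i0].
  by rewrite ssum_single ?expr0 ?mulr1// => n; exact: s.
by rewrite ssum_single => [|n]; [rewrite !expr0n gtn_eqF// mulr0 mul0r|exact: s].
Qed.

Lemma represents_neq0 x0 y0 c f : represents x0 y0 c f -> c 0%N 0%N != 0 ->
  near_point x0 y0 (fun x y => f x y != 0).
Proof.
move=> rc c0; have [K [B [r [[B0 r0] Br gc _ E]]]] := represents2 (ltr0n R 4) rc rc.
have B0' := ltW B0; have K0 := geometric_bound2_ge0 gc.
have c0' : 0 < `|c 0%N 0%N| by rewrite normr_gt0.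
have KB0 : 0 <= K * B by rewrite mulr_ge0.
have d0 : 0 < 8 * (K * B) + 1 by lra.
(* The value differs from [c 0 0] by at most [4 K B |h| + 2 K B |k|], which this radius keeps below
   [|c 0 0|]. *)
apply: near_point_of_shift; exists (Num.min r (`|c 0%N 0%N| / (8 * (K * B) + 1))).
  by rewrite lt_min r0 divr_gt0.
move=> h k; rewrite !lt_min !ltr_pdivlMr// => /andP[hr hc] /andP[kr kc].
have [-> _] := E _ _ hr kr.
have bh := ball_bound B0 Br (ltr0n R 4) hr; have bk := ball_bound B0 Br (ltr0n R 4) kr.
have q4 : 0 <= (4^-1 : R) <= 2^-1 by lra.
have row i : geometric_bound (K * (B * `|h|) ^+ i) (B * `|k|)
    (fun j => c i j * h ^+ i * k ^+ j).
  move=> j; rewrite !normrM !normrX.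
  have -> : K * (B * `|h|) ^+ i * (B * `|k|) ^+ j = K * B ^+ (i + j) * `|h| ^+ i * `|k|
    ^+ j.
    by rewrite exprD !exprMn; ring.
  by rewrite !ler_wpM2r ?exprn_ge0.
have nh := mulr_ge0 B0' (normr_ge0 h); have nk := mulr_ge0 B0' (normr_ge0 k).
have qk : 0 <= B * `|k| <= 2^-1 by lra.
have qh : 0 <= B * `|h| <= 2^-1 by lra.
have col : geometric_bound (2 * K) (B * `|h|) (fun i => ssum (fun j => c i j * h ^+ i *
  k ^+ j)).
  by move=> i; apply: le_trans (ssum_le qk (row i)) _; rewrite mulrA.
have := ssum_tail_le 1 qh col; have := ssum_tail_le 1 qk (row 0%N).
rewrite /series /= !big_mkord !big_ord1 !expr0 !expr1 !mulr1 -/(eval2 c h k) => A1 A2.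
apply/eqP => ev0; rewrite ev0 in A2.
have := ler_normD (c 0%N 0%N - ssum (fun j => c 0%N j * 1 * k ^+ j)) (ssum (fun j => c
  0%N j * 1 * k ^+ j)).
rewrite subrK => A3; move: A2; rewrite sub0r normrN => A2; rewrite distrC in A1.
nra.
Qed.

End Represents.

(** * Majorants *)

Section Majorants.
Variable R : realType.
Implicit Types (X Y : nat -> nat -> R) (a b : R).

(** The inverse square makes the weights stable under binomial convolution, and 8 is the
    normalization that brings the constant of this stability down to 1. *)
Definition majorant_weight n : R := n`!%:R / (8 * n.+1%:R ^+ 2).
Local Notation H := majorant_weight.

Lemma sum_inv_sqr_le n : \sum_(k < n.+1) (k.+1%:R ^+ 2)^-1 <= 2 - n.+1%:R^-1 :> R.
Proof.
elim: n => [|n IH]; first by rewrite big_ord1 expr1n invr1; lra.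
rewrite big_ord_recr /=; apply: le_trans (lerD IH (lexx _)) _.
rewrite -[n.+2%:R]natr1; set x : R := n.+1%:R.
have x0 : 0 < x by rewrite ltr0n.
rewrite -subr_ge0.
have -> : 2 - (x + 1)^-1 - (2 - x^-1 + ((x + 1) ^+ 2)^-1) = (x * (x + 1) ^+ 2)^-1.
  by field; rewrite !gt_eqF//; lra.
by rewrite invr_ge0 mulr_ge0 ?exprn_ge0//; lra.
Qed.

(** As [(x + y)^2 / (x y)^2 = (1/x + 1/y)^2], this is [(p + q)^2 <= 2 (p^2 + q^2)]. *)
Lemma inv_sqr_mul_le (x y : R) : 0 < x -> 0 < y ->
  (x ^+ 2)^-1 * (y ^+ 2)^-1 <= 2 * ((x + y) ^+ 2)^-1 * ((x ^+ 2)^-1 + (y ^+ 2)^-1).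
Proof.
move=> x0 y0; have xy : 0 < x + y by lra.
rewrite -subr_ge0.
have -> : 2 * ((x + y) ^+ 2)^-1 * ((x ^+ 2)^-1 + (y ^+ 2)^-1) - (x ^+ 2)^-1 * (y ^+ 2)^-1
   = (x - y) ^+ 2 * ((x + y) ^+ 2 * x ^+ 2 * y ^+ 2)^-1.
  by field; rewrite !gt_eqF.
by rewrite -!exprMn -exprVn mulr_ge0 ?sqr_ge0.
Qed.

Lemma majorant_weight_gt0 n : 0 < H n.
Proof. by rewrite divr_gt0 ?ltr0n ?fact_gt0// mulr_gt0 ?exprn_gt0 ?ltr0n. Qed.

(** The factorials cancel the binomials. By [inv_sqr_mul_le], with [x + y = n + 2], and two sums of
    inverse squares below 2, the rest is at most [8 / (n + 2)^2], against a prefactor [n! / 64]. *)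
Lemma majorant_weight_conv n :
  \sum_(e < n.+1) 'C(n, e)%:R * (H e * H (n - e)) <= H n.
Proof.
have -> : \sum_(e < n.+1) 'C(n, e)%:R * (H e * H (n - e)) =
    n`!%:R / 64 * \sum_(e < n.+1) (e.+1%:R ^+ 2)^-1 * ((n - e).+1%:R ^+ 2)^-1.
  rewrite mulr_sumr; apply: eq_bigr => e _.
  have en : (e <= n)%N by rewrite -ltnS.
  rewrite /H -(bin_fact en) !natrM.
  by field; rewrite !nat1r !pnatr_eq0.
set S := \sum_(e < n.+1) _.
have S8 : S <= 8 * (n.+2%:R ^+ 2)^-1.
  apply: (@le_trans _ _ (\sum_(e < n.+1) 2 * (n.+2%:R ^+ 2)^-1 *
      ((e.+1%:R ^+ 2)^-1 + ((n - e).+1%:R ^+ 2)^-1))).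
    apply: ler_sum => e _; have en : (e <= n)%N by rewrite -ltnS.
    have -> : n.+2%:R = e.+1%:R + (n - e).+1%:R :> R.
      by rewrite -natrD addSn addnS subnKC.
    by apply: inv_sqr_mul_le; rewrite ltr0n.
  rewrite -mulr_sumr big_split /=.
  rewrite [X in _ + X](reindex_inj rev_ord_inj) /=.
  under [X in _ + X]eq_bigr => e _ do rewrite subSS subKn -1?ltnS//.
  have Sn := sum_inv_sqr_le n.
  set T := \sum_(k < n.+1) _ in Sn *.
  have T2 : T <= 2.
    by apply: le_trans Sn _; rewrite gerBl invr_ge0 ler0n.
  have p : 0 <= (n.+2%:R ^+ 2)^-1 :> R by rewrite invr_ge0 exprn_ge0.
  have -> : 8 / n.+2%:R ^+ 2 = 2 / n.+2%:R ^+ 2 * 4 :> R by ring.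
  by rewrite ler_wpM2l ?mulr_ge0//; lra.
apply: le_trans (ler_wpM2l _ S8) _; first by rewrite divr_ge0.
rewrite /H -mulrA ler_wpM2l//.
rewrite [leLHS](_ : _ = (8 * n.+2%:R ^+ 2)^-1).
  rewrite lef_pV2 ?posrE ?mulr_gt0 ?exprn_gt0 ?ltr0n//.
  by rewrite ler_pM2l// lerXn2r ?nnegrE// ler_nat.
by field; rewrite -natrD pnatr_eq0.
Qed.

Lemma majorant_weight_step n : H n <= 4 * H n.+1.
Proof.
rewrite /H factS natrM -!mulrA.
rewrite [4 * _](_ : _ = n`!%:R * (4 * n.+1%:R / (8 * n.+2%:R ^+ 2))); last by ring.
rewrite ler_wpM2l// -[n.+2%:R]natr1.
have: (1 : R) <= n.+1%:R by rewrite ler1n.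
move: (n.+1%:R : R) => x x1; have x0 : 0 < x by lra.
have y0 : 0 < x + 1 by lra.
rewrite -[leLHS]mul1r ler_pdivlMr ?mulr_gt0 ?exprn_gt0//.
rewrite mulrAC ler_pdivrMr ?mulr_gt0 ?exprn_gt0//.
have a1 : 0 <= x ^+ 2 * (x - 1) by rewrite mulr_ge0 ?sqr_ge0//; lra.
have a2 : 0 <= (x - 1) * (3 * x + 1) by rewrite mulr_ge0//; lra.
nra.
Qed.

Lemma majorant_weight0 : H 0 = 8^-1.
Proof. by rewrite /H fact0 expr1n mulr1 mul1r. Qed.

Lemma sum_binS n (g : nat -> R) :
  \sum_(k < n.+2) 'C(n.+1, k)%:R * g k = \sum_(k < n.+1) 'C(n, k)%:R * (g k + g k.+1).
Proof.
rewrite big_ord_recl bin0 mul1r /=.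
under eq_bigr => k _ do rewrite /bump add1n binS natrD mulrDl.
rewrite big_split /= addrA.
rewrite [X in g _ + X]big_ord_recr /= bin_small// mul0r addr0.
under [RHS]eq_bigr do rewrite mulrDr.
rewrite [RHS]big_split /=; congr (_ + _).
by rewrite [RHS]big_ord_recl bin0 mul1r.
Qed.

(** Vandermonde's convolution tested against a function of [k + l]; in this form it follows from
    Pascal's rule by induction on [i]. *)
Lemma sum_Vandermonde i j (f : nat -> R) :
  \sum_(k < i.+1) \sum_(l < j.+1) 'C(i, k)%:R * 'C(j, l)%:R * f (k + l)%N =
  \sum_(e < (i + j).+1) 'C(i + j, e)%:R * f e.
Proof.
elim: i f => [|i IH] f.
  by rewrite big_ord1; apply: eq_bigr => l _; rewrite bin0 mul1r.
rewrite addSn sum_binS -(IH (fun e => f e + f e.+1)).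
under eq_bigr do (under eq_bigr do rewrite -mulrA; rewrite -mulr_sumr).
rewrite (sum_binS i (fun k => \sum_(l < j.+1) 'C(j, l)%:R * f (k + l)%N)).
apply: eq_bigr => k _; rewrite -big_split mulr_sumr /=.
by apply: eq_bigr => l _; rewrite -mulrDr mulrA addSn.
Qed.

Variables th rho : R.
Hypotheses (th1 : 1 <= th) (rho1 : 1 <= rho).

(** The weight is a parameter because differentiation shifts it. *)
Definition majorized (w : nat -> R) a X := forall i j,
  `|X i j| * (i`! * j`!)%:R <= a * th ^+ i * rho ^+ (i + j) * w (i + j)%N.

Let th0 : 0 <= th. Proof. exact: le_trans ler01 th1. Qed.
Let rho0 : 0 <= rho. Proof. exact: le_trans ler01 rho1. Qed.

Let weight_ge0 i j n : 0 <= th ^+ i * rho ^+ j * H n.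
Proof.
apply: mulr_ge0; last exact/ltW/majorant_weight_gt0.
by apply: mulr_ge0; exact: exprn_ge0.
Qed.

Lemma majorized_ge0 a X : majorized H a X -> 0 <= a.
Proof.
move=> /(_ 0%N 0%N); rewrite !mulr1 => p.
by rewrite -(pmulr_lge0 _ (majorant_weight_gt0 0)); apply: le_trans p.
Qed.

Lemma majorized_le a b X : a <= b -> majorized H a X -> majorized H b X.
Proof.
move=> ab mX i j; apply: le_trans (mX i j) _.
by rewrite -!mulrA ler_wpM2r// mulrA.
Qed.

Lemma majorizedD a b X Y : majorized H a X -> majorized H b Y -> majorized H (a + b)
  (add2 X Y).
Proof.
move=> mX mY i j; rewrite !mulrDl.
apply: le_trans (ler_wpM2r _ (ler_normD _ _)) _ => //.
by rewrite mulrDl; exact: lerD (mX i j) (mY i j).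
Qed.

Lemma majorized_const (z : R) : majorized H (8 * `|z|) (const2 z).
Proof.
move=> i j; rewrite /const2; case: ifP => [/andP[/eqP -> /eqP ->]|_].
  by rewrite majorant_weight0 !expr0 !mulr1 mulrAC divff// mul1r.
by rewrite normr0 mul0r -!mulrA mulr_ge0// mulr_ge0// mulrA.
Qed.

(** The powers of [th] and [rho] factor out, and the remaining weights depend on [k + l] alone, so
    Vandermonde reduces the double sum to [majorant_weight_conv]. *)
Lemma majorizedM a b X Y : majorized H a X -> majorized H b Y -> majorized H (a * b)
  (conv2 X Y).
Proof.
move=> mX mY i j; have a0 := majorized_ge0 mX; have b0 := majorized_ge0 mY.
rewrite /conv2 /diag.
apply: (@le_trans _ _ (a * b * th ^+ i * rho ^+ (i + j) *
  \sum_(k < i.+1) \sum_(l < j.+1) 'C(i, k)%:R * 'C(j, l)%:R *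
    (H (k + l) * H (i + j - (k + l))))).
  rewrite mulr_sumr; apply: le_trans (ler_wpM2r _ (ler_norm_sum _ _ _)) _ => //.
  rewrite mulr_suml; apply: ler_sum => k _; have ki : (k <= i)%N by rewrite -ltnS.
  rewrite mulr_sumr; apply: le_trans (ler_wpM2r _ (ler_norm_sum _ _ _)) _ => //.
  rewrite mulr_suml; apply: ler_sum => l _; have lj : (l <= j)%N by rewrite -ltnS.
  have := ler_pM _ _ (mX k l) (mY (i - k)%N (j - l)%N).
  rewrite !mulr_ge0// => /(_ isT isT) XY.
  rewrite normrM -(bin_fact ki) -(bin_fact lj) !natrM.
  have C0 : 0 <= 'C(i, k)%:R * 'C(j, l)%:R :> R by rewrite mulr_ge0.
  have := ler_wpM2l C0 XY; rewrite !natrM => {}XY.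
  have E1 : th ^+ i = th ^+ k * th ^+ (i - k) by rewrite -exprD subnKC.
  have E2 : rho ^+ (i + j) = rho ^+ (k + l) * rho ^+ (i - k + (j - l)).
    by rewrite -exprD addnACA !subnKC.
  have E3 : (i + j - (k + l) = i - k + (j - l))%N by lia.
  rewrite E1 E2 E3; apply: le_trans (le_trans _ XY) _.
    by rewrite le_eqVlt; apply/orP; left; apply/eqP; ring.
  by rewrite le_eqVlt; apply/orP; left; apply/eqP; ring.
rewrite (sum_Vandermonde i j (fun e => H e * H (i + j - e))).
rewrite ler_wpM2l ?majorant_weight_conv// !mulr_ge0 ?exprn_ge0//.
Qed.

Lemma majorized_weight (w w' : nat -> R) C a X : 0 <= a ->
  (forall n, w n <= C * w' n) -> majorized w a X -> majorized w' (C * a) X.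
Proof.
move=> a0 ww' mX i j; apply: le_trans (mX i j) _.
rewrite (_ : C * a * _ * _ * _ = a * th ^+ i * rho ^+ (i + j) * (C * w' (i + j)%N));
  last by ring.
by rewrite ler_wpM2l// !mulr_ge0// exprn_ge0.
Qed.

Lemma majorized_D1 w a X : majorized w a X ->
  majorized (fun n => w n.+1) (a * (th * rho)) (D1 X).
Proof.
move=> mX i j; have := mX i.+1 j; rewrite addSn factS /D1 normrM normr_nat.
rewrite !natrM !exprS => mXi; apply: le_trans (le_trans _ mXi) _.
  by rewrite le_eqVlt; apply/orP; left; apply/eqP; ring.
by rewrite le_eqVlt; apply/orP; left; apply/eqP; ring.
Qed.

Lemma majorized_D2 w a X : majorized w a X ->
  majorized (fun n => w n.+1) (a * rho) (D2 X).
Proof.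
move=> mX i j; have := mX i j.+1; rewrite addnS factS /D2 normrM normr_nat.
rewrite !natrM !exprS => mXi; apply: le_trans (le_trans _ mXi) _.
  by rewrite le_eqVlt; apply/orP; left; apply/eqP; ring.
by rewrite le_eqVlt; apply/orP; left; apply/eqP; ring.
Qed.

(** Two differentiations turn this weight into [H] itself. The truncated subtraction gives orders 0,
    1 and 2 the same weight [H 0]. *)
Definition tight a X := majorized (fun n => H (n - 2)) a X.

Lemma tight_weight1 n : H (n.+1 - 2) <= 4 * H n.
Proof.
case: n => [|n]; last by rewrite !subSS subn0 majorant_weight_step.
by change (1 - 2)%N with 0%N; have := majorant_weight_gt0 0; lra.
Qed.

Lemma tight_weight0 n : H (n - 2) <= 16 * H n.
Proof.
case: n => [|n]; first by have := majorant_weight_gt0 0; rewrite sub0n; lra.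
by have := tight_weight1 n; have := majorant_weight_step n; lra.
Qed.

Section Tight.
Variables (a : R) (X : nat -> nat -> R).
Hypotheses (a0 : 0 <= a) (tX : tight a X).

Lemma tight0 : majorized H (16 * a) X.
Proof. exact: majorized_weight tight_weight0 tX. Qed.

Lemma tight_D1 : majorized H (4 * (a * (th * rho))) (D1 X).
Proof.
apply: (majorized_weight _ tight_weight1 (majorized_D1 tX)).
by rewrite !mulr_ge0.
Qed.

Lemma tight_D2 : majorized H (4 * (a * rho)) (D2 X).
Proof.
apply: (majorized_weight _ tight_weight1 (majorized_D2 tX)).
by rewrite !mulr_ge0.
Qed.

Lemma tight_D11 : majorized H (a * (th * rho) * (th * rho)) (D1 (D1 X)).
Proof. by have := majorized_D1 (majorized_D1 tX); under [X in majorized X]eq_fun do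
  rewrite subn2. Qed.

Lemma tight_D12 : majorized H (a * (th * rho) * rho) (D2 (D1 X)).
Proof. by have := majorized_D2 (majorized_D1 tX); under [X in majorized X]eq_fun do
  rewrite subn2. Qed.

Lemma tight_D22 : majorized H (a * rho * rho) (D2 (D2 X)).
Proof. by have := majorized_D2 (majorized_D2 tX); under [X in majorized X]eq_fun do
  rewrite subn2. Qed.

(** The weight is at most [(i + j)!], and [(i + j)! <= 2^(i + j) i! j!]. *)
Lemma tight_geometric : geometric_bound2 a (2 * th * rho) X.
Proof.
move=> i j; have := tX i j.
have w1 : H (i + j - 2) <= (i + j)`!%:R.
  apply: (@le_trans _ _ (i + j - 2)`!%:R); last by rewrite ler_nat leq_fact// leq_subr.
  rewrite ler_pdivrMr ?mulr_gt0 ?exprn_gt0 ?ltr0n// ler_peMr//.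
  have : 1 <= (i + j - 2).+1%:R ^+ 2 :> R by rewrite exprn_ege1// ler1n.
  by lra.
have C2 : 'C(i + j, i)%:R <= 2 ^+ (i + j) :> R.
  rewrite -natrX ler_nat -[2%N]/(1 + 1)%N (Pascal 1 1).
  rewrite (bigD1 (Ordinal (leq_addr j i : (i < (i + j).+1)%N)))//= !exp1n !muln1.
  exact: leq_addr.
have f0 : 0 < (i`! * j`!)%:R :> R by rewrite ltr0n muln_gt0 !fact_gt0.
have e : (i + j)`!%:R = 'C(i + j, i)%:R * (i`! * j`!)%:R :> R.
  by rewrite -natrM -(bin_fact (leq_addr j i)) addKn.
move=> t; rewrite -(ler_pM2r f0); apply: le_trans t _.
apply: (@le_trans _ _ (a * th ^+ i * rho ^+ (i + j) * (2 ^+ (i + j) * (i`! * j`!)%:R))).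
  rewrite ler_wpM2l ?mulr_ge0 ?exprn_ge0//; apply: le_trans w1 _.
  by rewrite e ler_wpM2r// ltW.
rewrite !exprMn [th ^+ (i + j)]exprD.
rewrite [leLHS](_ : _ = a * th ^+ i * rho ^+ (i + j) * 2 ^+ (i + j) * (i`! * j`!)%:R *
  1); last by ring.
rewrite [leRHS](_ : _ = a * th ^+ i * rho ^+ (i + j) * 2 ^+ (i + j) * (i`! * j`!)%:R *
  th ^+ j); last by ring.
rewrite ler_wpM2l ?exprn_ege1// !mulr_ge0 ?exprn_ge0//.
Qed.

End Tight.

End Majorants.

(** * The formal solution *)

Section FormalSolution.
Variable R : realType.
Implicit Types (X Y M U : nat -> nat -> R) (a b : R).

Local Notation "a +' b" := (add2 a b) (at level 50, left associativity).
Local Notation "a *' b" := (conv2 a b) (at level 40, left associativity).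

(* The weight 2i + j is such that every leading derivative of the system, m_12
   and u_11, outweighs all the other derivatives in its equation. *)
Definition agree N X Y := forall i j, (2 * i + j < N)%N -> X i j = Y i j.

Lemma agree_leq N N' X Y : (N' <= N)%N -> agree N X Y -> agree N' X Y.
Proof. by move=> NN' XY i j ij; apply: XY; exact: leq_trans NN'. Qed.

Lemma agreeD N X X' Y Y' : agree N X X' -> agree N Y Y' -> agree N (X +' Y) (X' +' Y').
Proof. by move=> XX' YY' i j ij; rewrite /add2 XX'// YY'. Qed.

Lemma agreeM N X X' Y Y' : agree N X X' -> agree N Y Y' -> agree N (X *' Y) (X' *' Y').
Proof.
move=> XX' YY' i j ij; apply: eq_bigr => k _; apply: eq_bigr => l _.
have := ltn_ord k; have := ltn_ord l => ? ?.
by rewrite XX' ?YY'//; lia.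
Qed.

(** Every index other than the origin has weight at least 1, so beside a factor that vanishes at the
    origin the other factor enters only at a strictly smaller weight. *)
Lemma agreeM0 N N' X X' Y Y' : (N <= N'.+1)%N -> X 0%N 0%N = 0 -> X' 0%N 0%N = 0 ->
  agree N X X' -> agree N' Y Y' -> agree N (X *' Y) (X' *' Y').
Proof.
move=> NN' X0 X'0 XX' YY' i j ij; apply: eq_bigr => k _; apply: eq_bigr => l _.
have := ltn_ord k; have := ltn_ord l => ? ?.
have [kl|kl] := boolP ((k == 0 :> nat)%N && (l == 0 :> nat)%N).
  by case/andP: kl => /eqP -> /eqP ->; rewrite X0 X'0 !mul0r.
by rewrite XX' ?YY'//; lia.
Qed.

Lemma agree_D1 N X Y : agree N X Y -> agree (N - 2) (D1 X) (D1 Y).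
Proof. by move=> XY i j ij; rewrite /D1 XY//; lia. Qed.

Lemma agree_D2 N X Y : agree N X Y -> agree (N - 1) (D2 X) (D2 Y).
Proof. by move=> XY i j ij; rewrite /D2 XY//; lia. Qed.

Variables (m0 u0 : R).

(** (L) multiplied by [u = u0 + U] and solved for [u0 m_12]. *)
Definition rhsM M U :=
  const2 (-1) *' (U *' D2 (D1 M)) +' (D1 U *' D2 M +' D2 U *' D1 M).

(** (C) multiplied by [u^2] and solved for [m0 u0 u_11]. The coefficients are frozen by
    [u^2 = u0^2 + U (u + u0)] and [m u = m0 u0 + (M u + m0 U)]. *)
Definition rhsU M U :=
  let m := const2 m0 +' M in let u := const2 u0 +' U in
  (const2 (u0 ^+ 2) *' D2 (D2 M) +' const2 (- (m0 * u0)) *' D2 (D2 U))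
  +' ((U *' (u +' const2 u0)) *' D2 (D2 M))
  +' const2 (-1) *' ((M *' u +' const2 m0 *' U) *' (D2 (D2 U) +' D1 (D1 U)))
  +' u *' (D1 U *' D1 M +' const2 (-1) *' (D2 U *' D2 M))
  +' m *' (D1 U *' D1 U +' D2 U *' D2 U)
  +' const2 (-1) *' (m *' (u *' u *' u *' u)).

Lemma conv2_00 X Y : (X *' Y) 0%N 0%N = X 0%N 0%N * Y 0%N 0%N.
Proof. by rewrite /conv2 /diag !big_ord1. Qed.

(** Taking [m_12] costs 3, but its factor [U] vanishes at the origin and returns 1. Solving for
    [m_12] regains 3, a net gain of 1 in each iteration. *)
Lemma agree_rhsM N M M' U U' : U 0%N 0%N = 0 -> U' 0%N 0%N = 0 ->
  agree N M M' -> agree N U U' -> agree (N - 2) (rhsM M U) (rhsM M' U').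
Proof.
move=> U0 U'0 MM' UU'.
have w P P' k : (k <= 2)%N -> agree (N - k) P P' -> agree (N - 2) P P'.
  by move=> k2; apply: agree_leq; lia.
have M1 := agree_D1 MM'; have U1 := agree_D1 UU'.
have M2 := w _ _ 1%N isT (agree_D2 MM'); have U2 := w _ _ 1%N isT (agree_D2 UU').
have M12 := agree_D2 M1.
apply: agreeD; last by apply: agreeD; apply: agreeM.
apply: agreeM => //; apply: (agreeM0 _ U0 U'0 _ M12); first by lia.
by apply: (w _ _ 0%N); rewrite ?subn0.
Qed.

Lemma agree_rhsU N M M' U U' : M 0%N 0%N = 0 -> M' 0%N 0%N = 0 ->
  U 0%N 0%N = 0 -> U' 0%N 0%N = 0 ->
  agree N M M' -> agree N U U' -> agree (N - 3) (rhsU M U) (rhsU M' U').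
Proof.
move=> M0 M'0 U0 U'0 MM' UU'.
have w P P' k : (k <= 3)%N -> agree (N - k) P P' -> agree (N - 3) P P'.
  by move=> k2; apply: agree_leq; lia.
have M1 := w _ _ 2%N isT (agree_D1 MM'); have U1 := w _ _ 2%N isT (agree_D1 UU').
have M2 := w _ _ 1%N isT (agree_D2 MM'); have U2 := w _ _ 1%N isT (agree_D2 UU').
have M22 : agree (N - 3) (D2 (D2 M)) (D2 (D2 M')).
  by apply: agree_leq (agree_D2 (agree_D2 MM')); lia.
have U22 : agree (N - 3) (D2 (D2 U)) (D2 (D2 U')).
  by apply: agree_leq (agree_D2 (agree_D2 UU')); lia.
have U11 : agree (N - 4) (D1 (D1 U)) (D1 (D1 U')).
  by apply: agree_leq (agree_D1 (agree_D1 UU')); lia.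
have {}MM' : agree (N - 3) M M' by apply: agree_leq MM'; lia.
have {}UU' : agree (N - 3) U U' by apply: agree_leq UU'; lia.
have mm' : agree (N - 3) (const2 m0 +' M) (const2 m0 +' M') by exact: agreeD.
have uu' : agree (N - 3) (const2 u0 +' U) (const2 u0 +' U') by exact: agreeD.
rewrite /rhsU; apply: agreeD; last by do 6?[apply: agreeM => //].
apply: agreeD; last by apply: agreeM => //; apply: agreeD; apply: agreeM.
apply: agreeD; last by apply: agreeM => //; apply: agreeD; do 2?[apply: agreeM => //].
apply: agreeD; last first.
  apply: agreeM => //; apply: (@agreeM0 _ (N - 4)); first by lia.
  - by rewrite /add2 !conv2_00 M0 U0 mul0r mulr0 addr0.
  - by rewrite /add2 !conv2_00 M'0 U'0 mul0r mulr0 addr0.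
  - by apply: agreeD; apply: agreeM.
  - by apply: agreeD => //; apply: agree_leq U22; lia.
apply: agreeD; first by apply: agreeD; apply: agreeM.
by do 2!apply: agreeM => //; exact: agreeD.
Qed.

Variables (dM dU : nat -> nat -> R).

Definition stepM M U i j := match i, j with
  | i'.+1, j'.+1 => rhsM M U i' j' / (u0 * (i'.+1%:R * j'.+1%:R))
  | _, _ => dM i j end.

Definition stepU M U i j := match i with
  | i'.+2 => rhsU M U i' j / (m0 * u0 * (i'.+2%:R * i'.+1%:R))
  | _ => dU i j end.

Lemma agree_stepM N M M' U U' : U 0%N 0%N = 0 -> U' 0%N 0%N = 0 ->
  agree N M M' -> agree N U U' -> agree N.+1 (stepM M U) (stepM M' U').
Proof.
move=> U0 U'0 MM' UU' [|i] [|j] ij //=.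
by rewrite (agree_rhsM U0 U'0 MM' UU')//; lia.
Qed.

Lemma agree_stepU N M M' U U' : M 0%N 0%N = 0 -> M' 0%N 0%N = 0 ->
  U 0%N 0%N = 0 -> U' 0%N 0%N = 0 ->
  agree N M M' -> agree N U U' -> agree N.+1 (stepU M U) (stepU M' U').
Proof.
move=> M0 M'0 U0 U'0 MM' UU' [|[|i]] j ij //=.
by rewrite (agree_rhsU M0 M'0 U0 U'0 MM' UU')//; lia.
Qed.

Hypotheses (dM0 : dM 0%N 0%N = 0) (dU0 : dU 0%N 0%N = 0).

Fixpoint approx n : (nat -> nat -> R) * (nat -> nat -> R) :=
  if n is n'.+1 then let p := approx n' in (stepM p.1 p.2, stepU p.1 p.2)
  else (const2 0, const2 0).

Lemma approx00 n : (approx n).1 0%N 0%N = 0 /\ (approx n).2 0%N 0%N = 0.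
Proof. by case: n => [|n]. Qed.

Lemma approx_agree n : agree n (approx n).1 (approx n.+1).1 /\
  agree n (approx n).2 (approx n.+1).2.
Proof.
elim: n => [|n [IH1 IH2]]; first by split.
have [a1 a2] := approx00 n; have [b1 b2] := approx00 n.+1.
by split; [exact: agree_stepM|exact: agree_stepU].
Qed.

Lemma approx_agree_leq n p : (n <= p)%N -> agree n (approx n).1 (approx p).1 /\
  agree n (approx n).2 (approx p).2.
Proof.
move=> /subnKC <-; elim: (p - n)%N => [|d [IH1 IH2]]; first by rewrite addn0; split.
have [A1 A2] := approx_agree (n + d); rewrite addnS.
by split=> i j ij; rewrite (IH1, IH2)// (A1, A2)//; exact: ltn_addr.
Qed.

(** Iterate [n] is final at weights below [n], so this is the first iterate guaranteed to be final
    at [(i, j)]. *)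
Definition solM i j := (approx (2 * i + j).+1).1 i j.
Definition solU i j := (approx (2 * i + j).+1).2 i j.

Lemma sol_agree n : agree n solM (approx n).1 /\ agree n solU (approx n).2.
Proof.
by split=> i j ij; have [A1 A2] := approx_agree_leq ij; rewrite -(A1, A2).
Qed.

Lemma sol_fixpoint : solM = stepM solM solU /\ solU = stepU solM solU.
Proof.
have s00 : solM 0%N 0%N = 0 /\ solU 0%N 0%N = 0 by exact: approx00.
split; apply/funext => i; apply/funext => j.
  have [A1 A2] := sol_agree (2 * i + j); have [B1 B2] := sol_agree (2 * i + j).+1.
  have [a1 a2] := approx00 (2 * i + j).
  rewrite (agree_stepM _ _ A1 A2) ?s00//; exact: B1.
have [A1 A2] := sol_agree (2 * i + j); have [B1 B2] := sol_agree (2 * i + j).+1.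
have [a1 a2] := approx00 (2 * i + j).
rewrite (agree_stepU _ _ _ _ A1 A2) ?s00//; exact: B2.
Qed.

End FormalSolution.

(** * The ball of majorants preserved by the iteration, and the choice of its scales *)

Section Bounds.
Variable R : realType.
Implicit Types (X Y M U : nat -> nat -> R).

(** The constant 160 is [8 * 16] for [- U m_12] (8 for the constant -1, 16 for [U]) plus [4 * 4] for
    each product of first derivatives. *)
Lemma majorized_rhsM th rho a (u0 : R) M U : 1 <= th -> 1 <= rho -> 0 <= a ->
  160 * a <= `|u0| -> tight th rho a M -> tight th rho a U ->
  majorized th rho (majorant_weight R) (`|u0| * (a * (th * rho) * rho)) (rhsM M U).
Proof.
move=> th1 rho1 a0 au tM tU.
have c0 z := majorized_const th1 rho1 (z : R).
have M1 := tight_D1 th1 rho1 a0 tM; have U1 := tight_D1 th1 rho1 a0 tU.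
have M2 := tight_D2 th1 rho1 a0 tM; have U2 := tight_D2 th1 rho1 a0 tU.
have U0 := tight0 th1 rho1 a0 tU; have M12 := tight_D12 tM.
have PD := @majorizedD R th rho; have PM := @majorizedM R th rho th1 rho1.
apply: majorized_le (PD _ _ _ _ (PM _ _ _ _ (c0 (-1)) (PM _ _ _ _ U0 M12))
  (PD _ _ _ _ (PM _ _ _ _ U1 M2) (PM _ _ _ _ U2 M1))) => //.
rewrite normrN1.
have p : 0 <= a * (th * rho) * rho by rewrite !mulr_ge0//; lra.
rewrite [leLHS](_ : _ = 160 * a * (a * (th * rho) * rho)); last by ring.
by rewrite ler_wpM2r.
Qed.

(** Here [p] and [P] bound the second derivatives in [y] and in [x], and [Q] bounds [m] and [u]. The
    linear terms, the nonlinear terms (with total coefficient 720) and [m u^4] each receive a third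
    of [w P]; hence 24, 2160 and 24. *)
Lemma rhsU_bound_le (a p P Q u m w v : R) : 0 <= a -> 0 <= p <= P ->
  0 <= u -> 0 <= m -> 8 * u <= Q -> 8 * m <= Q ->
  24 * (v + w) * p <= w * P -> 2160 * Q * a * P <= w * P -> 24 * Q ^+ 5 <= w * P ->
  8 * v * p + 8 * w * p + 16 * a * (Q + 8 * u) * p
  + 8 * 1 * ((16 * a * Q + 8 * m * (16 * a)) * (p + P))
  + Q * (16 * (a * P) + 8 * 1 * (16 * (a * p)))
  + Q * (16 * (a * P) + 16 * (a * p)) + 8 * 1 * (Q * (Q * Q * Q * Q)) <= w * P.
Proof.
move=> a0 /andP[p0 pP] u0 m0 uQ mQ h1 h2 h3.
have Q0 : 0 <= Q by lra.
have P0 : 0 <= P by lra.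
have k1 : a * Q * p <= a * Q * P by rewrite ler_wpM2l ?mulr_ge0.
have k2 : a * (8 * u) * p <= a * Q * P by apply: ler_pM; rewrite ?mulr_ge0// ler_wpM2l.
have k3 : a * (8 * m) * p <= a * Q * P by apply: ler_pM; rewrite ?mulr_ge0// ler_wpM2l.
have k4 : a * (8 * m) * P <= a * Q * P by apply: ler_pM; rewrite ?mulr_ge0// ler_wpM2l.
rewrite [leLHS](_ : _ = 8 * (v + w) * p + 8 * Q ^+ 5 + 288 * (a * Q * p)
  + 16 * (a * (8 * u) * p) + 128 * (a * (8 * m) * p) + 128 * (a * (8 * m) * P)
  + 160 * (a * Q * P)); last by ring.
lra.
Qed.

Lemma majorized_rhsU th rho a Q (m0 u0 : R) M U : 1 <= th -> 1 <= rho -> 0 <= a <= 1 ->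
  Q = 8 * (`|m0| + `|u0|) + 16 ->
  24 * (u0 ^+ 2 + `|m0 * u0|) <= `|m0 * u0| * th ^+ 2 ->
  2160 * Q * a <= `|m0 * u0| ->
  24 * Q ^+ 5 <= `|m0 * u0| * (a * rho ^+ 2) ->
  tight th rho a M -> tight th rho a U ->
  majorized th rho (majorant_weight R) (`|m0 * u0| * (a * (th * rho) * (th * rho)))
    (rhsU m0 u0 M U).
Proof.
move=> th1 rho1 /andP[a0 a1] QE h1 h2 h3 tM tU.
have m00 := normr_ge0 m0; have u00 := normr_ge0 u0.
have c0 z := majorized_const th1 rho1 (z : R).
have M0 := tight0 th1 rho1 a0 tM; have U0 := tight0 th1 rho1 a0 tU.
have M1 := tight_D1 th1 rho1 a0 tM; have U1 := tight_D1 th1 rho1 a0 tU.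
have M2 := tight_D2 th1 rho1 a0 tM; have U2 := tight_D2 th1 rho1 a0 tU.
have M22 := tight_D22 tM; have U22 := tight_D22 tU; have U11 := tight_D11 tU.
have PD := @majorizedD R th rho; have PM := @majorizedM R th rho th1 rho1.
have mM : majorized th rho (majorant_weight R) Q (add2 (const2 m0) M).
  by apply: majorized_le (PD _ _ _ _ (c0 m0) M0) => //; lra.
have mU : majorized th rho (majorant_weight R) Q (add2 (const2 u0) U).
  by apply: majorized_le (PD _ _ _ _ (c0 u0) U0) => //; lra.
have T1 := PD _ _ _ _ (PM _ _ _ _ (c0 (u0 ^+ 2)) M22) (PM _ _ _ _ (c0 (- (m0 * u0))) U22).
have T2 := PM _ _ _ _ (PM _ _ _ _ U0 (PD _ _ _ _ mU (c0 u0))) M22.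
have T3 := PM _ _ _ _ (c0 (-1)) (PM _ _ _ _ (PD _ _ _ _ (PM _ _ _ _ M0 mU)
  (PM _ _ _ _ (c0 m0) U0)) (PD _ _ _ _ U22 U11)).
have T4 := PM _ _ _ _ mU (PD _ _ _ _ (PM _ _ _ _ U1 M1)
  (PM _ _ _ _ (c0 (-1)) (PM _ _ _ _ U2 M2))).
have T5 := PM _ _ _ _ mM (PD _ _ _ _ (PM _ _ _ _ U1 U1) (PM _ _ _ _ U2 U2)).
have T6 := PM _ _ _ _ (c0 (-1)) (PM _ _ _ _ mM (PM _ _ _ _ (PM _ _ _ _
  (PM _ _ _ _ mU mU) mU) mU)).
apply: majorized_le (PD _ _ _ _ (PD _ _ _ _ (PD _ _ _ _ (PD _ _ _ _ (PD _ _ _ _ T1 T2)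
  T3) T4) T5) T6) => //.
set p := a * rho * rho; set P := a * (th * rho) * (th * rho).
have p0 : 0 <= p by rewrite !mulr_ge0//; lra.
have PE : P = th ^+ 2 * p by rewrite /P /p; ring.
have pP : p <= P by rewrite PE ler_peMl// exprn_ege1.
have P0 : 0 <= P by apply: le_trans pP.
rewrite !normrN normr1 normrX real_normK ?num_real//.
apply: le_trans (rhsU_bound_le (a := a) (p := p) (P := P) (Q := Q) (u := `|u0|) (m :=
  `|m0|)
  (w := `|m0 * u0|) (v := u0 ^+ 2) _ _ _ _ _ _ _ _ _) => //.
- by rewrite le_eqVlt; apply/orP; left; apply/eqP; rewrite /P /p; ring.
- by rewrite p0.
- by lra.
- by lra.
- by rewrite PE [leRHS]mulrA ler_wpM2r.
- by rewrite ler_wpM2r.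
- apply: le_trans h3 _; rewrite ler_wpM2l//.
  by rewrite (_ : a * rho ^+ 2 = p)// /p expr2 mulrA.
Qed.

(* The x-scale th makes the linear terms small, the amplitude a makes the
   nonlinear ones small, and the overall scale rho absorbs the data and the
   only term without derivatives, m u^4. *)
Lemma majorant_scales (m0 u0 D : R) : m0 != 0 -> u0 != 0 -> 0 <= D ->
  exists th rho a, [/\ 1 <= th /\ 1 <= rho, 0 < a <= 1 /\ 160 * a <= `|u0|,
    24 * (u0 ^+ 2 + `|m0 * u0|) <= `|m0 * u0| * th ^+ 2 /\
    2160 * (8 * (`|m0| + `|u0|) + 16) * a <= `|m0 * u0|,
    24 * (8 * (`|m0| + `|u0|) + 16) ^+ 5 <= `|m0 * u0| * (a * rho ^+ 2) &
    D <= a * rho / 8].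
Proof.
move=> m00 u00 D0.
set w := `|m0 * u0|; have w0 : 0 < w by rewrite normr_gt0 mulf_neq0.
have au0 : 0 < `|u0| by rewrite normr_gt0.
have : 0 < 8 * (`|m0| + `|u0|) + 16 by have := normr_ge0 m0; lra.
move: (8 * (`|m0| + `|u0|) + 16) => Q Q0.
exists (1 + 24 * (u0 ^+ 2 + w) / w).
have n1 : 0 < 160 :> R by rewrite ltr0n.
have n2 : 0 < 2160 * Q by rewrite mulr_gt0 ?ltr0n.
have [a [a0 a1 ha h2]] : exists a, [/\ 0 < a, a <= 1, 160 * a <= `|u0| & 2160 * Q * a
  <= w].
  exists (Num.min 1 (Num.min (`|u0| / 160) (w / (2160 * Q)))).
  split; first by rewrite !lt_min ltr01 !divr_gt0.
  - by rewrite ge_min lexx.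
  - by rewrite mulrC -(ler_pdivlMr _ _ n1) !ge_min lexx orbT.
  - by rewrite mulrC -(ler_pdivlMr _ _ n2) !ge_min lexx !orbT.
have wa : 0 < w * a by rewrite mulr_gt0.
have r1 : 0 <= 24 * Q ^+ 5 / (w * a) by rewrite divr_ge0 ?mulr_ge0 ?exprn_ge0// ltW.
have r2 : 0 <= 8 * D / a by rewrite divr_ge0 ?mulr_ge0// ltW.
have [rho [rho1 rhoQ rhoD]] : exists rho, [/\ 1 <= rho, 24 * Q ^+ 5 / (w * a) <= rho &
  8 * D / a <= rho].
  exists (1 + 24 * Q ^+ 5 / (w * a) + 8 * D / a).
  by move: r1 r2; move: (_ / (w * a)) (_ / a) => x y x0 y0; split; lra.
exists rho, a; split.
- by split=> //; rewrite lerDl divr_ge0 ?mulr_ge0 ?addr_ge0 ?sqr_ge0// ltW.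
- by rewrite a0.
- split=> //; set th := 1 + _.
  have th1 : 1 <= th by rewrite lerDl divr_ge0 ?mulr_ge0 ?addr_ge0 ?sqr_ge0// ltW.
  apply: (@le_trans _ _ (w * th)); last first.
    by rewrite ler_pM2l// expr2 ler_peMr// (le_trans ler01).
  have -> : w * th = w + 24 * (u0 ^+ 2 + w) by rewrite /th; field; rewrite gt_eqF.
  by rewrite lerDr ltW.
- rewrite [leRHS]mulrA [leRHS]mulrC -ler_pdivrMr//; apply: (le_trans rhoQ).
  by rewrite expr2 ler_peMr// (le_trans ler01).
- by move: rhoD; rewrite ler_pdivrMr// => hD; lra.
Qed.

Lemma formal_solution (m0 u0 : R) (dM dU : nat -> nat -> R) : m0 != 0 -> u0 != 0 ->
  dM 0%N 0%N = 0 -> dU 0%N 0%N = 0 ->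
  (forall i j, (2 < i + j)%N -> dM i j = 0 /\ dU i j = 0) ->
  exists M U K B,
    [/\ 0 < B /\ geometric_bound2 K B M, geometric_bound2 K B U,
      (forall i j, (i == 0)%N || (j == 0)%N -> M i j = dM i j) /\
      (forall i j, (i < 2)%N -> U i j = dU i j),
      forall i j, u0 * D2 (D1 M) i j = rhsM M U i j &
      forall i j, m0 * u0 * D1 (D1 U) i j = rhsU m0 u0 M U i j].
Proof.
move=> m00 u00 dM0 dU0 d3.
have w0 : 0 < `|m0 * u0| by rewrite normr_gt0 mulf_neq0.
have au0 : 0 < `|u0| by rewrite normr_gt0.
have D0 : 0 <= \sum_(i < 3) \sum_(j < 3) (`|dM i j| + `|dU i j|) * (i`! * j`!)%:R.
  by do 2!(apply: sumr_ge0 => ? _); rewrite mulr_ge0 ?addr_ge0.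
have [th [rho [a [[th1 rho1] [/andP[a0 a1] ha] [h1 h2] h3 hD]]]] := majorant_scales m00
  u00 D0.
have th0 : 0 <= th by lra.
have rho0 : 0 <= rho by lra.
have rhs0 i j : 0 <= a * th ^+ i * rho ^+ (i + j) * majorant_weight R (i + j - 2).
  apply: mulr_ge0; last exact/ltW/majorant_weight_gt0.
  by rewrite !mulr_ge0 ?exprn_ge0// ltW.
have data X : X 0%N 0%N = 0 -> (forall i j, (2 < i + j)%N -> X i j = 0) ->
    (forall i j : 'I_3, `|X i j| <= `|dM i j| + `|dU i j|) -> tight th rho a X.
  move=> X0 X3 XD i j.
  (* The vanishing constant term matters: only for [i + j > 0] does the majorant contain the factor
     [rho] that absorbs the data. *)
  have [ij0|ij0] := eqVneq (i + j)%N 0%N.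
    move/eqP: ij0 (rhs0 i j); rewrite addn_eq0 => /andP[/eqP -> /eqP ->] ?.
    by rewrite X0 normr0 mul0r.
  have [ij3|ij3] := ltnP 2 (i + j); first by rewrite X3// normr0 mul0r.
  have i3 : (i < 3)%N by rewrite ltnS; apply: leq_trans ij3; exact: leq_addr.
  have j3 : (j < 3)%N by rewrite ltnS; apply: leq_trans ij3; exact: leq_addl.
  have -> : (i + j - 2 = 0)%N by apply/eqP; rewrite subn_eq0.
  rewrite majorant_weight0.
  apply: le_trans (le_trans _ hD) _.
    rewrite (bigD1 (Ordinal i3))//= (bigD1 (Ordinal j3))//= -addrA.
    apply: (@le_trans _ _ ((`|dM i j| + `|dU i j|) * (i`! * j`!)%:R)).
      by rewrite ler_wpM2r//; exact: (XD (Ordinal i3) (Ordinal j3)).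
    rewrite lerDl addr_ge0// ?sumr_ge0// => *; rewrite ?sumr_ge0// => *;
      by rewrite ?mulr_ge0 ?addr_ge0.
  rewrite ler_pM2r ?invr_gt0// -mulrA ler_pM2l//.
  apply: (@le_trans _ _ (rho ^+ (i + j))).
    by case: (i + j)%N ij0 => // n _; rewrite exprS ler_peMr ?exprn_ege1.
  by rewrite ler_peMl ?exprn_ege1 ?exprn_ge0.
have tdM : tight th rho a dM.
  by apply: data => // [i j /d3[]//|i j]; rewrite lerDl.
have tdU : tight th rho a dU.
  by apply: data => // [i j /d3[]//|i j]; rewrite lerDr.
have t0 : tight th rho a (const2 0).
  by move=> i j; rewrite /const2 if_same normr0 mul0r.
have a0' := ltW a0; have aP : 0 <= a <= 1 by rewrite a0'.
have step M U : tight th rho a M -> tight th rho a U ->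
    tight th rho a (stepM u0 dM M U) /\ tight th rho a (stepU m0 u0 dU M U).
  move=> tM tU; split=> [[|i] [|j]|[|[|i]] j]; [exact: tdM..| |exact: tdU|exact: tdU|].
    have := majorized_rhsM th1 rho1 a0' ha tM tU i j.
    rewrite /= addSn addnS subn2 /= !factS !natrM => H.
    rewrite normrM normfV !normrM !normr_nat.
    rewrite [leLHS](_ : _ = `|rhsM M U i j| * (i`!%:R * j`!%:R) / `|u0|); last first.
      by field; rewrite !nat1r !pnatr_eq0 normr_eq0 u00.
    rewrite ler_pdivrMr//; apply: le_trans H _.
    by rewrite le_eqVlt; apply/orP; left; apply/eqP; rewrite !exprS; ring.
  have := majorized_rhsU th1 rho1 aP erefl h1 h2 h3 tM tU i j.
  rewrite /= !addSn subn2 /= !factS !natrM => H.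
  rewrite normrM normfV !normrM !normr_nat.
  rewrite [leLHS](_ : _ = `|rhsU m0 u0 M U i j| * (i`!%:R * j`!%:R) / `|m0 * u0|); last
    first.
    by rewrite normrM; field; rewrite -?natrD ?nat1r !pnatr_eq0 !normr_eq0 u00 m00.
  rewrite ler_pdivrMr//; apply: le_trans H _.
  by rewrite le_eqVlt; apply/orP; left; apply/eqP; rewrite !exprS; ring.
have tA n : tight th rho a (approx m0 u0 dM dU n).1 /\ tight th rho a (approx m0 u0 dM
  dU n).2.
  by elim: n => [|n [IH1 IH2]] //=; exact: step.
have [EM EU] := sol_fixpoint m0 u0 dM0 dU0.
set M := solM m0 u0 dM dU in EM EU *; set U := solU m0 u0 dM dU in EM EU *.
exists M, U, a, (2 * th * rho).
have B0 : 0 < 2 * th * rho by rewrite !mulr_gt0//; lra.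
split.
- split=> //; apply: tight_geometric => // i j; exact: (tA _).1.
- by apply: tight_geometric => // i j; exact: (tA _).2.
- by split=> [[|i] [|j]|[|[|i]] j] //= _; rewrite ?EM ?EU.
- by move=> i j; rewrite /D2 /D1 {1}EM /=; field; rewrite !nat1r !pnatr_eq0 u00.
- move=> i j; rewrite /D1 {1}EU /=; field.
  by rewrite -?natrD ?nat1r !pnatr_eq0 m00 u00.
Qed.

End Bounds.

(** * Local analytic solutions *)

Section Existence.
Variable R : realType.
Implicit Types (X Y M U : nat -> nat -> R) (f g : R -> R -> R).

Lemma conv2_const (z : R) X : conv2 (const2 z) X = fun i j => z * X i j.
Proof.
apply/funext => i; apply/funext => j; rewrite /conv2 /diag.
rewrite big_ord_recl [X in _ + X]big1 ?addr0 => [|k _]; last first.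
  by rewrite big1// => l _; rewrite /const2 /= mul0r.
rewrite big_ord_recl [X in _ + X]big1 ?addr0 => [|l _]; last first.
  by rewrite /const2 /= mul0r.
by rewrite !subn0.
Qed.

Lemma D1_const (z : R) X : D1 (add2 (const2 z) X) = D1 X.
Proof. by apply/funext => i; apply/funext => j; rewrite /D1 /add2 /const2 /= add0r. Qed.

Lemma D2_const (z : R) X : D2 (add2 (const2 z) X) = D2 X.
Proof.
by apply/funext => i; apply/funext => j; rewrite /D2 /add2 /const2 /= andbF add0r.
Qed.

Lemma eqC_cleared (m u m1 m2 u1 u2 m22 u22 u11 : R) : u != 0 ->
  m22 = - (u1 / u * m1 - u2 / u * m2) +
        m * (u ^+ 2 + ((u11 / u - (u1 / u) ^+ 2) + (u22 / u - (u2 / u) ^+ 2))) <->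
  m * u * u11 = u ^+ 2 * m22 - m * u * u22 + u * (u1 * m1 - u2 * m2)
    + m * (u1 ^+ 2 + u2 ^+ 2) - m * u ^+ 4.
Proof.
move=> u0; split=> [->|E]; first by field.
have u20 : u ^+ 2 != 0 by rewrite expf_eq0.
apply: (mulfI u20); rewrite (_ : u ^+ 2 * m22 = m * u * u11 + m * u * u22 - u * (u1 *
  m1 - u2 * m2)
    - m * (u1 ^+ 2 + u2 ^+ 2) + m * u ^+ 4); last by rewrite E; ring.
by field.
Qed.

(** Taylor coefficients of the freely prescribed part of the jet. The values of [m] and [u] are
    split off as constants, and [m_12] and [u_11] are left to the equations. *)
Definition dataM (j : 'rV[R]_14) (i k : nat) : R := match i, k with
  | 1, 0 => j 0 jm1 | 2, 0 => j 0 jm11 / 2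
  | 0, 1 => j 0 jm2 | 0, 2 => j 0 jm22 / 2
  | _, _ => 0 end.

Definition dataU (j : 'rV[R]_14) (i k : nat) : R := match i, k with
  | 1, 0 => j 0 ju1 | 1, 1 => j 0 ju12
  | 0, 1 => j 0 ju2 | 0, 2 => j 0 ju22 / 2
  | _, _ => 0 end.

Lemma is_derive_quotient (f g : R -> R) (x df dg : R) : g x != 0 ->
  is_derive x 1 f df -> is_derive x 1 g dg ->
  derive1 (fun t => f t / g t) x = df / g x - f x * dg / g x ^+ 2.
Proof.
move=> g0 Df Dg; rewrite derive1E.
have DV := is_deriveV g0 Dg; have D := is_deriveM Df DV.
rewrite (@derive_val _ _ _ _ _ _ _ D) /GRing.scale /=.
by field.
Qed.

Lemma manifold_eqs (j : 'rV[R]_14) : manifold (restricted_contact_system R) j ->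
  [/\ j 0 jm != 0, j 0 ju != 0,
    j 0 jm12 = jet_gamma1 j * j 0 jm2 + jet_gamma2 j * j 0 jm1 &
    j 0 jm22 = - (jet_gamma1 j * j 0 jm1 - jet_gamma2 j * j 0 jm2)
                + j 0 jm * (j 0 ju ^+ 2 + jet_div_gamma j)].
Proof.
move=> [[m0 u0] /= /rowP E]; split=> //.
  by have := E ord0; rewrite !mxE /= => /eqP; rewrite subr_eq0 => /eqP.
by have := E (lift ord0 ord0); rewrite !mxE /= => /eqP; rewrite subr_eq0 => /eqP.
Qed.

Lemma local_existence (j : 'rV[R]_14) : manifold (restricted_contact_system R) j ->
  exists (U : set (R * R)) (m u : R -> R -> R),
    [/\ open U, U (j 0 jz1, j 0 jz2), analytic_solution U m u &
        jet2 m u (j 0 jz1) (j 0 jz2) = j].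
Proof.
move=> /manifold_eqs[m0 u0 E12 E22].
have [|M [U [K [B [[B0 gM] gU [MdM UdU] EM EU]]]]] := formal_solution
  (dM := dataM j) (dU := dataU j) m0 u0 erefl erefl.
  by move=> [|[|[|i]]] [|[|[|k]]].
have [x0 x0E] : exists x0, x0 = j 0 jz1 by eexists.
have [y0 y0E] : exists y0, y0 = j 0 jz2 by eexists.
rewrite -x0E -y0E.
pose fM x y := eval2 M (x - x0) (y - y0); pose fU x y := eval2 U (x - x0) (y - y0).
have rep X : geometric_bound2 K B X ->
    represents x0 y0 X (fun x y => eval2 X (x - x0) (y - y0)).
  move=> gX; exists K, B, 1; split=> // h k _ _.
  by rewrite [x0 + h]addrC [y0 + k]addrC !addrK.
have rM : represents x0 y0 M fM := rep _ gM; have rU : represents x0 y0 U fU := rep _ gU.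
have c0 z := represents_const x0 y0 (z : R).
pose m x y := j 0 jm + fM x y; pose u x y := j 0 ju + fU x y.
have rm : represents x0 y0 (add2 (const2 (j 0 jm)) M) m := representsD (c0 _) rM.
have ru : represents x0 y0 (add2 (const2 (j 0 ju)) U) u := representsD (c0 _) rU.
have rm1 := represents_d1 rm; have ru1 := represents_d1 ru.
have rm2 := represents_d2 rm; have ru2 := represents_d2 ru.
have uE x y : fU x y = u x y - j 0 ju by rewrite /u addrC addKr.
have mE x y : fM x y = m x y - j 0 jm by rewrite /m addrC addKr.
rewrite D1_const in rm1; rewrite D1_const in ru1; rewrite D2_const in rm2; rewrite
  D2_const in ru2.
clearbody m u fM fU.
have rm12 := represents_d2 rm1; have rm22 := represents_d2 rm2.
have ru11 := represents_d1 ru1; have ru22 := represents_d2 ru2.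
have rm11 := represents_d1 rm1; have ru12 := represents_d2 ru1.
have PM := @representsM R x0 y0; have PD := @representsD R x0 y0.
(* For each equation the left side is represented by [rhsM] or [rhsU] through the recursion, and the
   right side by the same array, assembled factor by factor; [T1] to [T6] are the six summands of
   [rhsU]. *)
have rL := PM _ _ _ _ (c0 (j 0 ju)) rm12.
rewrite conv2_const (_ : (fun i k => _) = rhsM M U) in rL; last first.
  by apply/funext => i; apply/funext => k; exact: EM.
have rL' := PD _ _ _ _ (PM _ _ _ _ (c0 (-1)) (PM _ _ _ _ rU rm12))
  (PD _ _ _ _ (PM _ _ _ _ ru1 rm2) (PM _ _ _ _ ru2 rm1)).
have nL := representsE rL rL'.
have rC := PM _ _ _ _ (c0 (j 0 jm * j 0 ju)) ru11.
rewrite conv2_const (_ : (fun i k => _) = rhsU (j 0 jm) (j 0 ju) M U) in rC; last first.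
  by apply/funext => i; apply/funext => k; exact: EU.
have T1 := PD _ _ _ _ (PM _ _ _ _ (c0 (j 0 ju ^+ 2)) rm22)
  (PM _ _ _ _ (c0 (- (j 0 jm * j 0 ju))) ru22).
have T2 := PM _ _ _ _ (PM _ _ _ _ rU (PD _ _ _ _ ru (c0 (j 0 ju)))) rm22.
have T3 := PM _ _ _ _ (c0 (-1)) (PM _ _ _ _ (PD _ _ _ _ (PM _ _ _ _ rM ru)
  (PM _ _ _ _ (c0 (j 0 jm)) rU)) (PD _ _ _ _ ru22 ru11)).
have T4 := PM _ _ _ _ ru (PD _ _ _ _ (PM _ _ _ _ ru1 rm1)
  (PM _ _ _ _ (c0 (-1)) (PM _ _ _ _ ru2 rm2))).
have T5 := PM _ _ _ _ rm (PD _ _ _ _ (PM _ _ _ _ ru1 ru1) (PM _ _ _ _ ru2 ru2)).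
have T6 := PM _ _ _ _ (c0 (-1)) (PM _ _ _ _ rm (PM _ _ _ _ (PM _ _ _ _
  (PM _ _ _ _ ru ru) ru) ru)).
have rC' := PD _ _ _ _ (PD _ _ _ _ (PD _ _ _ _ (PD _ _ _ _ (PD _ _ _ _ T1 T2) T3) T4)
  T5) T6.
have nC := representsE rC rC'.
have M00 : add2 (const2 (j 0 jm)) M 0%N 0%N = j 0 jm by rewrite /add2 MdM//= addr0.
have U00 : add2 (const2 (j 0 ju)) U 0%N 0%N = j 0 ju by rewrite /add2 UdU//= addr0.
have nm : near_point x0 y0 (fun x y => m x y != 0).
  by apply: (represents_neq0 rm); rewrite M00.
have nu : near_point x0 y0 (fun x y => u x y != 0).
  by apply: (represents_neq0 ru); rewrite U00.
have am := represents_analytic rm.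
have au := represents_analytic ru.
have du1 := represents_derivable1 ru.
have du2 := represents_derivable2 ru.
have du11 := represents_derivable1 ru1.
have du22 := represents_derivable2 ru2.
have [r r0 near] := near_point_and (near_point_and (near_point_and am au)
  (near_point_and nm nu)) (near_point_and (near_point_and nL nC)
  (near_point_and (near_point_and du1 du2) (near_point_and du11 du22))).
have sol : analytic_solution (ball ((x0, y0) : R * R) r) m u.
  move=> x y [/= xr yr].
  have [[[amx aux] [mx ux]] [[Lx Cx] [[D1x D2x] [D11x D22x]]]] := near _ _ xr yr.
  split=> //; rewrite /Defs.eqL /Defs.eqC.
    rewrite /gamma1 /gamma2.
    apply: (mulfI ux); transitivity (d1 u x y * d2 m x y + d2 u x y * d1 m x y).
      by rewrite -[d1 u x y * _ + _](addKr (-1 * (fU x y * d2 (d1 m) x y))) -Lx uE; ring.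
    by field.
  have -> : div_gamma u x y = (d1 (d1 u) x y / u x y - (d1 u x y / u x y) ^+ 2)
      + (d2 (d2 u) x y / u x y - (d2 u x y / u x y) ^+ 2).
    rewrite /div_gamma.
    have -> : d1 (gamma1 u) x y = _ := is_derive_quotient ux D11x D1x.
    have -> : d2 (gamma2 u) x y = _ := is_derive_quotient ux D22x D2x.
    by field.
  apply/eqC_cleared => //.
  rewrite uE mE in Cx; move/eqP: Cx; rewrite -subr_eq0 => /eqP Z.
  by apply/eqP; rewrite -subr_eq0 -Z; apply/eqP; ring.
exists (ball ((x0, y0) : R * R) r), m, u; split=> //.
- exact: ball_open.
- exact: ballxx.
have xx : ball ((x0, y0) : R * R) r (x0, y0) by exact: ballxx.
have [_ _ Lx Cx] := sol _ _ xx.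
have e0 : m x0 y0 = j 0 jm by rewrite (represents_center rm).
have e1 : d1 m x0 y0 = j 0 jm1 by rewrite (represents_center rm1) /D1 MdM//= mul1r.
have e2 : d2 m x0 y0 = j 0 jm2 by rewrite (represents_center rm2) /D2 MdM//= mul1r.
have e11 : d1 (d1 m) x0 y0 = j 0 jm11.
  by rewrite (represents_center rm11) /D1 MdM//= mul1r mulrC divfK.
have e22 : d2 (d2 m) x0 y0 = j 0 jm22.
  by rewrite (represents_center rm22) /D2 MdM//= mul1r mulrC divfK.
have f0 : u x0 y0 = j 0 ju by rewrite (represents_center ru).
have f1 : d1 u x0 y0 = j 0 ju1 by rewrite (represents_center ru1) /D1 UdU//= mul1r.
have f2 : d2 u x0 y0 = j 0 ju2 by rewrite (represents_center ru2) /D2 UdU//= mul1r.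
have f12 : d2 (d1 u) x0 y0 = j 0 ju12.
  by rewrite (represents_center ru12) /D2 /D1 UdU//= !mul1r.
have f22 : d2 (d2 u) x0 y0 = j 0 ju22.
  by rewrite (represents_center ru22) /D2 UdU//= mul1r mulrC divfK.
have e12 : d2 (d1 m) x0 y0 = j 0 jm12.
  by rewrite Lx E12 /gamma1 /gamma2 e1 e2 f0 f1 f2.
(* This entry was not prescribed. The jet and the solution satisfy the same cleared form of (C) with
   equal remaining entries, and the coefficient [m u] of [u_11] is nonzero. *)
have f11 : d1 (d1 u) x0 y0 = j 0 ju11.
  have xr : `|x0 - x0| < r by rewrite subrr normr0.
  have yr : `|y0 - y0| < r by rewrite subrr normr0.
  have [_ [[_ {}Cx] _]] := near _ _ xr yr.
  have {}E22 := proj1 (eqC_cleared _ _ _ _ _ _ _ _ u0) E22.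
  apply: (mulfI (mulf_neq0 m0 u0)).
  by rewrite E22 Cx uE mE e0 e1 e2 e22 f0 f1 f2 f22 !subrr; ring.
apply/rowP => k; rewrite mxE.
case: k => -[|[|[|[|[|[|[|[|[|[|[|[|[|[|n]]]]]]]]]]]]]] h //=;
  rewrite ?(x0E, y0E, e0, e1, e2, e11, e12, e22, f0, f1, f2, f11, f12, f22);
  by congr (j 0 _); exact: val_inj.
Qed.

End Existence.

(** * The tableau *)

Section Tableau.
Variables (K : numFieldType) (c : K).
Hypothesis c0 : c != 0.

(* Rows are indexed by the contact forms of m, m_1, m_2, u, u_1, u_2; the
   vector y collects the components along dm_11, du_11, du_12, du_22, and the
   symbol of (C) gives m_22 = c (u_11 + u_22) with c = m / u. *)
Definition symbol (y : 'rV[K]_4) : 'M[K]_(6, 2) :=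
  \matrix_(a, i) nth 0 (nth [::]
    [:: [:: 0; 0]; [:: y 0 0; 0]; [:: 0; c * (y 0 1 + y 0 3)];
        [:: 0; 0]; [:: y 0 1; y 0 2]; [:: y 0 2; y 0 3]] a) i.

Lemma symbol_linear : linear symbol.
Proof.
move=> k y z; apply/matrixP => -[[|[|[|[|[|[|n]]]]]] ha] [[|[|m]] hi] //; rewrite !mxE
  /= ?mxE.
all: by ring.
Qed.

HB.instance Definition _ := GRing.isLinear.Build K _ _ _ symbol symbol_linear.

Definition symbol_space : {vspace 'M[K]_(6, 2)} := limg (linfun symbol).

Lemma symbol_spaceP M : reflect (exists y, M = symbol y) (M \in symbol_space).
Proof.
apply: (iffP memv_imgP) => [[y _ ->]|[y ->]]; exists y; rewrite ?lfunE ?memvf//.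
Qed.

Lemma row4P (y : 'rV[K]_4) : y 0 0 = 0 -> y 0 1 = 0 -> y 0 2 = 0 -> y 0 3 = 0 -> y = 0.
Proof.
move=> y0 y1 y2 y3; apply/rowP => -[[|[|[|[|n]]]] h] //; rewrite mxE.
- by rewrite -[RHS]y0; congr (y 0 _); exact: val_inj.
- by rewrite -[RHS]y1; congr (y 0 _); exact: val_inj.
- by rewrite -[RHS]y2; congr (y 0 _); exact: val_inj.
- by rewrite -[RHS]y3; congr (y 0 _); exact: val_inj.
Qed.

Lemma dim_limg_inj (aT rT : vectType K) (f : 'Hom(aT, rT)) (U : {vspace aT}) :
  (forall v, v \in U -> f v = 0 -> v = 0) -> \dim (f @: U) = \dim U.
Proof.
move=> f0; rewrite -[RHS](limg_ker_dim f U) (_ : (U :&: lker f)%VS = 0%VS) ?dimv0//.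
apply/eqP; rewrite -subv0; apply/subvP => v; rewrite memv_cap memv_ker memv0.
by case/andP => vU /eqP /(f0 _ vU) ->.
Qed.

Lemma symbol_inj y : symbol y = 0 -> y = 0.
Proof.
move=> /matrixP E; apply: row4P.
- by have := E 1 0; rewrite !mxE.
- by have := E 4 0; rewrite !mxE.
- by have := E 4 1; rewrite !mxE.
- by have := E 5 1; rewrite !mxE.
Qed.

Lemma dim_symbol_space : \dim symbol_space = 4%N.
Proof.
rewrite dim_limg_inj => [|y _]; first by rewrite dimvf /dim /= mul1n.
by rewrite lfunE; exact: symbol_inj.
Qed.

Definition column_projection (g : 'M[K]_2) k (M : 'M[K]_(6, 2)) : 'M[K]_(6, 2) :=
  M *m g *m pid_mx k.

Lemma column_projection_linear g k : linear (column_projection g k).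
Proof. by move=> a M N; rewrite /column_projection !mulmxDl -!scalemxAl. Qed.

HB.instance Definition _ g k := GRing.isLinear.Build K _ _ _ (column_projection g k)
  (column_projection_linear g k).

Lemma column_rankE (g : 'M[K]_2) k :
  column_rank symbol_space g k = \dim (linfun (column_projection g k) @: symbol_space)%VS.
Proof. by []. Qed.

Lemma column_rank_le4 g k : (column_rank symbol_space g k <= 4)%N.
Proof.
apply: leq_trans (_ : _ <= \dim symbol_space)%N _; last by rewrite dim_symbol_space.
rewrite column_rankE -[leqRHS](limg_ker_dim (linfun (column_projection g k))).
exact: leq_addl.
Qed.

Lemma column_rank0 g : column_rank symbol_space g 0 = 0%N.
Proof.
rewrite column_rankE; apply/eqP; rewrite dimv_eq0 -subv0; apply/subvP => v.
move=> /memv_imgP[M _ ->]; rewrite lfunE /= /column_projection.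
by rewrite pid_mx_0 mulmx0 memv0.
Qed.

Lemma column_rank2 g : g \in unitmx -> column_rank symbol_space g 2 = 4%N.
Proof.
move=> ug; rewrite column_rankE dim_limg_inj ?dim_symbol_space// => M _.
rewrite lfunE /= /column_projection pid_mx_1 mulmx1 => /(congr1 (mulmxr (invmx g))) /=.
by rewrite mulmxK// mul0mx.
Qed.

(* The first column is the value of the symbol on dz1 + dz2, which is not
   characteristic, unlike dz1 and dz2. *)
Definition diagonal_flag : 'M[K]_2 := \matrix_(i, j) ((j <= i)%N)%:R.

Lemma diagonal_flag_unit : diagonal_flag \in unitmx.
Proof.
rewrite unitmxE det_trig; last by apply/is_trig_mxP => i j ij; rewrite mxE leqNgt ij.
by rewrite big1 ?unitr1// => i _; rewrite mxE leqnn.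
Qed.

(** On the kernel, the rows of [u_1] and [u_2] give [y1 = - y2 = y3], while the row of [m_2] gives
    [y1 = - y3], so [2 y1 = 0]. *)
Lemma column_rank_diagonal_flag : column_rank symbol_space diagonal_flag 1 = 4%N.
Proof.
rewrite column_rankE dim_limg_inj ?dim_symbol_space// => M /symbol_spaceP[y ->].
rewrite lfunE /= /column_projection => /matrixP E.
have {}E a : symbol y a 0 + symbol y a 1 = 0.
  have := E a 0; rewrite !mxE !big_ord_recl big_ord0 !mxE !big_ord_recl !big_ord0 !mxE /=.
  by rewrite !mulr1 !mulr0 !addr0.
have := E 1; have := E 2; have := E 4; have := E 5; rewrite !mxE /=.
move=> e5 e4 /eqP; rewrite add0r mulf_eq0 (negPf c0) /= => /eqP e2; rewrite addr0 => e1.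
have -> : y = 0.
  have q1 : y 0 1 = 0.
    have : 2 * y 0 1 = 0.
      have -> : 2 * y 0 1 = (y 0 1 + y 0 2) - (y 0 2 + y 0 3) + (y 0 1 + y 0 3) by ring.
      by rewrite e4 e5 e2 subr0 addr0.
    by move/eqP; rewrite mulf_eq0 pnatr_eq0 /= => /eqP.
  have q2 : y 0 2 = 0 by rewrite q1 add0r in e4.
  by apply: row4P => //; rewrite q1 add0r in e2.
exact: linear0.
Qed.

(** The value 4 of [s_1] is maximal because it is the dimension; every flag attaining it then has
    [s_2 = 0], so the second maximum is attained too. *)
Lemma maximizing_diagonal_flag : maximizing_flag symbol_space 2 diagonal_flag.
Proof.
split=> [|g' [ug']].
  split=> [|g' ug']; first exact: diagonal_flag_unit.
  rewrite /flag_character column_rank_diagonal_flag !column_rank0 subn0.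
  by rewrite subn0 column_rank_le4.
move=> /(_ _ diagonal_flag_unit) r4.
have {}r4 : (4 <= column_rank symbol_space g' 1)%N.
  by move: r4; rewrite /flag_character !column_rank0 !subn0 column_rank_diagonal_flag.
by rewrite {1}/flag_character (column_rank2 ug') (eqP (_ : 4 - _ == 0)%N)// subn_eq0.
Qed.

Definition symbol_characters (k : nat) : nat := if k == 1%N then 4 else 0.

Lemma reduced_characters_symbol : reduced_characters symbol_space symbol_characters.
Proof.
exists diagonal_flag; first exact: maximizing_diagonal_flag.
move=> [|[|[|k]]] // _; rewrite /flag_character column_rank_diagonal_flag.
  by rewrite column_rank0 subn0.
by rewrite column_rank2 ?diagonal_flag_unit.
Qed.

(** The parameters are [m_111, u_111, u_112, u_222]. Differentiating [m_12 = 0] gives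
    [m_112 = m_122 = 0], and [m_122 = c (u_111 + u_122)] then forces [u_122 = - u_111]. *)
Definition symbol_prolonged (y : 'rV[K]_4) : {ffun 'I_2 -> 'M[K]_(6, 2)} :=
  [ffun j : 'I_2 => symbol (\row_k nth 0 (nth [::]
    [:: [:: y 0 0; y 0 1; y 0 2; - y 0 1]; [:: 0; y 0 2; - y 0 1; y 0 3]] j) k)].

Lemma symbol_prolonged_linear : linear symbol_prolonged.
Proof.
move=> k y z; apply/ffunP => j; rewrite !ffunE -linearP; congr symbol; apply/rowP => l.
case: j => -[|[|j]] hj //; case: l => -[|[|[|[|l]]]] hl //; rewrite !mxE /= ?mxE.
all: by ring.
Qed.

HB.instance Definition _ := GRing.isLinear.Build K _ _ _ symbol_prolonged
  symbol_prolonged_linear.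

Lemma prolongation_symbol : prolongation symbol_space = limg (linfun symbol_prolonged).
Proof.
apply/vspaceP => P; apply/prolongationP/memv_imgP => [[PA Ps]|[y _ ->]]; last first.
  rewrite lfunE /=; split=> [j|a i j].
    by rewrite ffunE; apply/symbol_spaceP; eexists.
  rewrite !ffunE !mxE.
  case: a => -[|[|[|[|[|[|a]]]]]] ha //; case: i => -[|[|i]] hi //; case: j => -[|[|j]]
    hj //=;
    rewrite ?mxE //=; ring.
have [y yE] := symbol_spaceP _ (PA 0); have [z zE] := symbol_spaceP _ (PA 1).
have e1 := Ps 1 1 0; have e2 := Ps 2 1 0; have e4 := Ps 4 1 0; have e5 := Ps 5 1 0.
rewrite yE zE !mxE /= in e1 e2 e4 e5.
have y3 : y 0 3 = - y 0 1.
  by apply/eqP; rewrite -addr_eq0 addrC; move/eqP: e2; rewrite mulf_eq0 (negPf c0).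
exists (\row_k nth 0 [:: y 0 0; y 0 1; y 0 2; z 0 3] k); rewrite ?memvf// lfunE /=.
apply/ffunP => j; rewrite ffunE.
have [->|->] : j = 0 \/ j = 1.
  by case: j => -[|[|j]] hj //; [left|right]; exact: val_inj.
  rewrite yE; congr symbol; apply/eqP; rewrite -subr_eq0; apply/eqP/row4P; rewrite !mxE
    /= ?mxE /= ?y3 ?subrr//.
rewrite zE; congr symbol; apply/eqP; rewrite -subr_eq0; apply/eqP/row4P; rewrite !mxE
  /= ?mxE /= -?e1 -?e4 -?e5 ?y3 ?subrr//.
Qed.

Lemma symbol_prolonged_inj y : symbol_prolonged y = 0 -> y = 0.
Proof.
move=> /ffunP E; have := E 0; have := E 1; rewrite !ffunE.
move=> /symbol_inj /rowP E1 /symbol_inj /rowP E0; apply: row4P.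
- by have := E0 0; rewrite !mxE.
- by have := E0 1; rewrite !mxE.
- by have := E0 2; rewrite !mxE.
- by have := E1 3; rewrite !mxE.
Qed.

Lemma involutive_symbol : involutive_tableau symbol_space.
Proof.
exists symbol_characters; first exact: reduced_characters_symbol.
rewrite prolongation_symbol dim_limg_inj => [|y _]; last first.
  by rewrite lfunE; exact: symbol_prolonged_inj.
by rewrite dimvf /dim /= mul1n big_ltn// big_ltn// big_geq.
Qed.

Lemma last_character_symbol : last_character symbol_space 1 4.
Proof.
split=> //; exists symbol_characters; first exact: reduced_characters_symbol.
by split=> // -[|[|k]].
Qed.

End Tableau.

(** * The contact system on the equation manifold *)

Section Geometry.
Variable R : realType.
Implicit Types (x v w : 'rV[R]_14).

Local Notation S := (restricted_contact_system R).

Lemma is_derive_affine (V W : normedModType R) (f : V -> W) (x v : V) (df : W) :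
  (forall h : R, f (h *: v + x) - f x = h *: df) -> is_derive x v f df.
Proof.
move=> fE.
suff lim : (fun h => h^-1 *: ((f \o shift x) (h *: v) - f x)) @ 0^' --> df.
  by apply: DeriveDef; [apply/cvg_ex; exists df|exact: cvg_lim].
apply: (cvg_near_cst df); near=> h.
have h0 : h != 0 by near: h; exact: nbhs_dnbhs_neq.
by rewrite /= fE scalerA mulVf// scale1r.
Unshelve. all: by end_near.
Qed.

Definition contact_index (a : 'I_6) : 'I_14 * 'I_14 * 'I_14 :=
  nth (jm, jm1, jm2) [:: (jm, jm1, jm2); (jm1, jm11, jm12); (jm2, jm12, jm22);
    (ju, ju1, ju2); (ju1, ju11, ju12); (ju2, ju12, ju22)] a.

Local Notation cf a := (contact_index a).1.1.
Local Notation cf1 a := (contact_index a).1.2.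
Local Notation cf2 a := (contact_index a).2.

Lemma col_contact_forms (a : 'I_6) x :
  col a (contact_forms x) = contact_form (cf a) (cf1 a) (cf2 a) x.
Proof.
apply/colP => k; rewrite [LHS]mxE [LHS]mxE.
by case: a => -[|[|[|[|[|[|a]]]]]] ha.
Qed.

Lemma pairing_dcoord v k : pairing v (dcoord R k) = v 0 k.
Proof. by rewrite /pairing /dcoord -colE mxE. Qed.

Lemma pairingD v (al be : 'cV[R]_14) : pairing v (al + be) = pairing v al + pairing v be.
Proof. by rewrite /pairing mulmxDr !mxE. Qed.

Lemma pairingN v (al : 'cV[R]_14) : pairing v (- al) = - pairing v al.
Proof. by rewrite /pairing mulmxN !mxE. Qed.

Lemma pairingB v (al be : 'cV[R]_14) : pairing v (al - be) = pairing v al - pairing v be.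
Proof. by rewrite /pairing mulmxBr !mxE. Qed.

Lemma pairingZ v k (al : 'cV[R]_14) : pairing v (k *: al) = k * pairing v al.
Proof. by rewrite /pairing -scalemxAr !mxE. Qed.

Lemma pairing_contact v x a : pairing v (col a (contact_forms x)) =
  v 0 (cf a) - x 0 (cf1 a) * v 0 jz1 - x 0 (cf2 a) * v 0 jz2.
Proof. by rewrite col_contact_forms /contact_form !pairingB !pairingZ !pairing_dcoord.
  Qed.

Lemma pairing_independence v x (i : 'I_2) : pairing v (col i (independence_forms x)) =
  v 0 (if i == 0 then jz1 else jz2).
Proof.
rewrite -pairing_dcoord; congr pairing; apply/colP => k; rewrite [LHS]mxE
  /independence_forms mxE.
by case: i => -[|[|i]] hi //; case: splitP => j /= e; rewrite (ord1 j)// in e *.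
Qed.

(** This is [- df_1 /\ dz1 - df_2 /\ dz2]; its sign reappears as [- delta_mx] in the structure
    equations. *)
Lemma dthetaE x a v w : dtheta S x a v w =
  w 0 (cf1 a) * v 0 jz1 + w 0 (cf2 a) * v 0 jz2
  - (v 0 (cf1 a) * w 0 jz1 + v 0 (cf2 a) * w 0 jz2).
Proof.
have D u : 'D_u (fun y => col a (contact_forms y)) x =
    - (u 0 (cf1 a) *: dcoord R jz1 + u 0 (cf2 a) *: dcoord R jz2).
  have [_ ->] : is_derive x u (fun y => col a (contact_forms y))
      (- (u 0 (cf1 a) *: dcoord R jz1 + u 0 (cf2 a) *: dcoord R jz2)) => //.
  apply: is_derive_affine => h; rewrite !col_contact_forms /contact_form.
  by apply/colP => k; rewrite !mxE; ring.
rewrite /dtheta /exterior_d !D /=.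
by rewrite !pairingN !pairingD !pairingZ !pairing_dcoord; ring.
Qed.

#[local] Instance is_derive_coord x v (k : 'I_14) :
  is_derive x v (fun j : 'rV[R]_14 => j 0 k) (v 0 k).
Proof. by apply: is_derive_affine => h; rewrite !mxE addrK. Qed.

Definition lhsL (j : 'rV[R]_14) : R :=
  j 0 jm12 - (jet_gamma1 j * j 0 jm2 + jet_gamma2 j * j 0 jm1).
Definition lhsC (j : 'rV[R]_14) : R :=
  j 0 jm22 - (- (jet_gamma1 j * j 0 jm1 - jet_gamma2 j * j 0 jm2)
                + j 0 jm * (j 0 ju ^+ 2 + jet_div_gamma j)).

(* Coefficients of dm_12, and of dm_22 modulo du_11 + du_22, along the tangent
   space, on dm, dm_1, dm_2, du, du_1, du_2. *)
Definition coefL x (b : 'I_6) : R :=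
  let g1 := jet_gamma1 x in let g2 := jet_gamma2 x in
  nth 0 [:: 0; g2; g1; - (g1 * x 0 jm2 + g2 * x 0 jm1) / x 0 ju;
    x 0 jm2 / x 0 ju; x 0 jm1 / x 0 ju] b.
Definition coefC x (b : 'I_6) : R :=
  let g1 := jet_gamma1 x in let g2 := jet_gamma2 x in
  nth 0 [:: x 0 ju ^+ 2 + jet_div_gamma x; - g1; g2;
    (g1 * x 0 jm1 - g2 * x 0 jm2
      + x 0 jm * (2 * x 0 ju ^+ 2 - (x 0 ju11 + x 0 ju22) / x 0 ju
                  + 2 * g1 ^+ 2 + 2 * g2 ^+ 2)) / x 0 ju;
    - (x 0 jm1 + 2 * x 0 jm * g1) / x 0 ju; (x 0 jm2 - 2 * x 0 jm * g2) / x 0 ju] b.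

Lemma is_derive_gamma x v k : x 0 ju != 0 ->
  is_derive x v (fun j : 'rV[R]_14 => j 0 k / j 0 ju)
    (v 0 k / x 0 ju - x 0 k / x 0 ju * (v 0 ju / x 0 ju)).
Proof.
move=> u0; have V : is_derive x v (fun j : 'rV[R]_14 => (j 0 ju)^-1)
    (- (x 0 ju) ^- 2 *: v 0 ju).
  have D := is_derive_coord x v ju.
  by apply: DeriveDef; [exact: derivableV|rewrite deriveV// derive_val].
apply: is_derive_eq (is_deriveM (is_derive_coord x v k) V) _.
by rewrite /GRing.scale /=; field.
Qed.

Lemma is_derive_lhsL x v : x 0 ju != 0 ->
  is_derive x v lhsL (v 0 jm12 - \sum_b coefL x b * v 0 (cf b)).
Proof.
move=> u0.
have G1 : is_derive x v (@jet_gamma1 R) _ := is_derive_gamma v ju1 u0.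
have G2 : is_derive x v (@jet_gamma2 R) _ := is_derive_gamma v ju2 u0.
have C k := is_derive_coord x v k.
apply: is_derive_eq (is_deriveB (C jm12) (is_deriveD (is_deriveM G1 (C jm2))
  (is_deriveM G2 (C jm1)))) _.
by rewrite !big_ord_recl big_ord0 /coefL /jet_gamma1 /jet_gamma2 /GRing.scale /=; field.
Qed.

Lemma is_derive_lhsC x v : x 0 ju != 0 ->
  is_derive x v lhsC (v 0 jm22 - (\sum_b coefC x b * v 0 (cf b)
    + x 0 jm / x 0 ju * (v 0 ju11 + v 0 ju22))).
Proof.
move=> u0.
have G1 : is_derive x v (@jet_gamma1 R) _ := is_derive_gamma v ju1 u0.
have G2 : is_derive x v (@jet_gamma2 R) _ := is_derive_gamma v ju2 u0.
have H1 := is_derive_gamma v ju11 u0.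
have H2 := is_derive_gamma v ju22 u0.
have C k := is_derive_coord x v k.
have dv : is_derive x v (@jet_div_gamma R) _ :=
  is_deriveD (is_deriveB H1 (is_deriveX 2 G1)) (is_deriveB H2 (is_deriveX 2 G2)).
apply: is_derive_eq (is_deriveB (C jm22) (is_deriveD (is_deriveN (is_deriveB
  (is_deriveM G1 (C jm1)) (is_deriveM G2 (C jm2))))
  (is_deriveM (C jm) (is_deriveD (is_deriveX 2 (C ju)) dv)))) _.
rewrite !big_ord_recl big_ord0 /coefC /jet_div_gamma /jet_gamma1 /jet_gamma2
  /GRing.scale /=.
by rewrite !fctE /=; field.
Qed.

Lemma differentiable_gamma x k : x 0 ju != 0 ->
  differentiable (fun j : 'rV[R]_14 => j 0 k / j 0 ju) x.
Proof.
move=> u0; apply: differentiableM; first exact: differentiable_coord.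
by apply: differentiableV => //; exact: differentiable_coord.
Qed.

Lemma jet_equationsE : @jet_equations R =
  (fun j => lhsL j *: delta_mx 0 0) + (fun j => lhsC j *: delta_mx 0 1).
Proof.
apply/funext => j; apply/rowP => i; rewrite fctE !mxE /=.
by case: i => -[|[|i]] hi //=; rewrite !(mulr1, mulr0) ?addr0 ?add0r.
Qed.

Lemma differentiable_lhs x : x 0 ju != 0 ->
  differentiable lhsL x /\ differentiable lhsC x.
Proof.
move=> u0; have C k : differentiable (fun j : 'rV[R]_14 => j 0 k) x.
  exact: differentiable_coord.
have G k := differentiable_gamma k u0.
have X (f : 'rV[R]_14 -> R) : differentiable f x -> differentiable (fun j => f j ^+ 2) x.
  move=> df; have -> : (fun j => f j ^+ 2) = f * f by apply/funext => j; rewrite fctE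
    expr2.
  exact: differentiableM.
split.
  apply: differentiableB; first exact: C.
  by apply: differentiableD; apply: differentiableM; first [exact: G|exact: C].
apply: differentiableB; first exact: C.
apply: differentiableD.
  by apply: differentiableN; apply: differentiableB; apply: differentiableM;
    first [exact: G|exact: C].
apply: differentiableM; first exact: C.
apply: differentiableD; first by apply: X; exact: C.
by apply: differentiableD; apply: differentiableB;
  first [exact: G|apply: X; exact: G].
Qed.

Lemma differentiable_jet_equations x : x 0 ju != 0 ->
  differentiable (@jet_equations R) x.
Proof.
move=> /differentiable_lhs[dL dC]; rewrite jet_equationsE.
by apply: differentiableD; apply: differentiableZl.
Qed.

Lemma derive_coord n (F : 'rV[R]_14 -> 'rV[R]_n) x v (i : 'I_n) : derivable F x v ->
  'D_v (fun j => F j 0 i) x = ('D_v F x) 0 i.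
Proof.
move=> dF; apply: cvg_lim => //.
have := cvg_comp _ _ dF (@coord_continuous R 1 n 0 i _).
by apply: cvg_trans; apply: near_eq_cvg; near=> h; rewrite /= !mxE.
Unshelve. all: by end_near.
Qed.

Lemma derive_jet_equations x v : x 0 ju != 0 ->
  v *m jacobian (@jet_equations R) x = \row_i (if i == 0
    then v 0 jm12 - \sum_b coefL x b * v 0 (cf b)
    else v 0 jm22 - (\sum_b coefC x b * v 0 (cf b)
      + x 0 jm / x 0 ju * (v 0 ju11 + v 0 ju22))).
Proof.
move=> u0; rewrite -deriveEjacobian; last exact: differentiable_jet_equations.
have dJ : derivable (@jet_equations R) x v.
  by apply: diff_derivable; exact: differentiable_jet_equations.
have DL := is_derive_lhsL v u0; have DC := is_derive_lhsC v u0.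
apply/rowP => i; rewrite -(derive_coord i dJ) mxE.
case: i => -[|[|i]] hi //.
  rewrite (_ : (fun j => _) = lhsL) ?derive_val//.
  by apply/funext => j; rewrite mxE.
rewrite (_ : (fun j => _) = lhsC) ?derive_val//.
by apply/funext => j; rewrite mxE.
Qed.

Lemma tangentP x v : x 0 ju != 0 ->
  reflect (v 0 jm12 = \sum_b coefL x b * v 0 (cf b) /\
           v 0 jm22 = \sum_b coefC x b * v 0 (cf b)
             + x 0 jm / x 0 ju * (v 0 ju11 + v 0 ju22))
    (v <= tangent S x)%MS.
Proof.
move=> u0; apply: (iffP sub_kermxP); rewrite derive_jet_equations//.
  move=> /rowP E; have := E 0; have := E 1; rewrite !mxE /= => /eqP + /eqP.
  by rewrite !subr_eq0 => /eqP ? /eqP.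
move=> [-> ->]; apply/rowP => i; rewrite !mxE !subrr; by case: ifP.
Qed.

(** The equations are solved for [m_12] and [m_22], so these two coordinate vectors are sent to the
    identity matrix. *)
Lemma rank_jacobian x : x 0 ju != 0 -> \rank (jacobian (@jet_equations R) x) = 2.
Proof.
move=> u0; apply/eqP; apply/row_fullP.
exists (\matrix_(i < 2) (delta_mx 0 (if i == 0 then jm12 else jm22) : 'rV[R]_14)).
apply/row_matrixP => i; rewrite row_mul rowK derive_jet_equations// row1.
have z (c : 'I_6 -> R) (k : 'I_14) : (k == jm12) || (k == jm22) ->
    \sum_b c b * (delta_mx 0 k : 'rV[R]_14) 0 (cf b) = 0.
  move=> hk; apply: big1 => b _; rewrite mxE.
  by case/orP: hk => /eqP ->; case: b => -[|[|[|[|[|[|b]]]]]] hb //=; rewrite mulr0.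
apply/rowP => k; rewrite mxE !z; [|by case: ifP..].
by case: i => -[|[|i]] hi //; case: k => -[|[|k]] hk //; rewrite !mxE /= ?(addr0,
  mulr0, subr0).
Qed.

Lemma rank_tangent x : x 0 ju != 0 -> \rank (tangent S x) = 12.
Proof. by move=> u0; rewrite mxrank_ker rank_jacobian. Qed.

End Geometry.

(** * A coframing of the equation manifold adapted to the contact forms *)

Section Structure.
Variable R : realType.
Implicit Types (x v w : 'rV[R]_14).

Local Notation S := (restricted_contact_system R).
Local Notation cf a := (contact_index a).1.1.
Local Notation cf1 a := (contact_index a).1.2.
Local Notation cf2 a := (contact_index a).2.

Lemma pairing_col v n (M : 'M[R]_(14, n)) k : pairing v (col k M) = (v *m M) 0 k.
Proof. by rewrite /pairing !mxE; apply: eq_bigr => l _; rewrite mxE. Qed.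

Lemma rank_mul_inj m n k (A : 'M[R]_(m, n)) (B : 'M[R]_(n, k)) :
  (forall v : 'rV_n, (v <= A)%MS -> v *m B = 0 -> v = 0) -> \rank (A *m B) = \rank A.
Proof.
move=> inj; rewrite -[RHS](mxrank_mul_ker A B) (_ : (A :&: kermx B)%MS = 0) ?mxrank0
  ?addn0//.
apply/eqP; rewrite -submx0; apply/rV_subP => v; rewrite sub_capmx => /andP[vA
  /sub_kermxP vB].
by rewrite (inj _ vA vB) sub0mx.
Qed.

(** Modulo the contact forms each [df] is [f_1 dz1 + f_2 dz2]. Hence [alpha] gives the coefficients
    of [dm_12] on [dz1] and [dz2], and [beta] those of [dm_22] apart from its [du_11 + du_22]
    part. *)
Definition alpha x (c : 'I_6 -> 'I_14) := \sum_b coefL x b * x 0 (c b).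
Definition beta x (c : 'I_6 -> 'I_14) := \sum_b coefC x b * x 0 (c b).

(* Correcting du_11 by a multiple of dz1, and dm_11 by a multiple of dz2,
   absorbs the torsion. *)
Definition tau x := (beta x (fun b => cf1 b) - alpha x (fun b => cf2 b)) / (x 0 jm / x
  0 ju).

Definition pi_forms x : 'M[R]_(14, 4) := \matrix_(k, e) (nth 0
  [:: dcoord R jm11 - alpha x (fun b => cf1 b) *: dcoord R jz2;
      dcoord R ju11 + tau x *: dcoord R jz1; dcoord R ju12; dcoord R ju22] e) k 0.

Lemma pairing_pi v x (e : 'I_4) : pairing v (col e (pi_forms x)) = nth 0
  [:: v 0 jm11 - alpha x (fun b => cf1 b) * v 0 jz2; v 0 ju11 + tau x * v 0 jz1;
      v 0 ju12; v 0 ju22] e.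
Proof.
have -> : col e (pi_forms x) = nth 0
  [:: dcoord R jm11 - alpha x (fun b => cf1 b) *: dcoord R jz2;
      dcoord R ju11 + tau x *: dcoord R jz1; dcoord R ju12; dcoord R ju22] e.
  by apply/colP => k; rewrite [LHS]mxE [LHS]mxE.
by case: e => -[|[|[|[|e]]]] he //=; rewrite ?pairingB ?pairingD ?pairingZ
  !pairing_dcoord.
Qed.

Lemma row14P v : (forall b, v 0 (cf b) = 0) -> v 0 jz1 = 0 -> v 0 jz2 = 0 ->
  v 0 jm11 = 0 -> v 0 jm12 = 0 -> v 0 jm22 = 0 ->
  v 0 ju11 = 0 -> v 0 ju12 = 0 -> v 0 ju22 = 0 -> v = 0.
Proof.
move=> vf z1 z2 m11 m12 m22 u11 u12 u22; apply/rowP => k; rewrite mxE.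
have [f0 f1 f2] := And3 (vf 0) (vf 1) (vf 2).
have [f3 f4 f5] := And3 (vf 3) (vf 4) (vf 5).
have e (l : 'I_14) : v 0 l = 0 -> k = l -> v 0 k = 0 by move=> ? ->.
case: k e => -[|[|[|[|[|[|[|[|[|[|[|[|[|[|k]]]]]]]]]]]]]] h // e.
- by apply: (e jz1) => //; exact: val_inj.
- by apply: (e jz2) => //; exact: val_inj.
- by apply: (e jm) => //; exact: val_inj.
- by apply: (e jm1) => //; exact: val_inj.
- by apply: (e jm2) => //; exact: val_inj.
- by apply: (e jm11) => //; exact: val_inj.
- by apply: (e jm12) => //; exact: val_inj.
- by apply: (e jm22) => //; exact: val_inj.
- by apply: (e ju) => //; exact: val_inj.
- by apply: (e ju1) => //; exact: val_inj.
- by apply: (e ju2) => //; exact: val_inj.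
- by apply: (e ju11) => //; exact: val_inj.
- by apply: (e ju12) => //; exact: val_inj.
- by apply: (e ju22) => //; exact: val_inj.
Qed.

Lemma vertical_contact v x : v 0 jz1 = 0 -> v 0 jz2 = 0 ->
  (forall a, pairing v (col a (contact_forms x)) = 0) -> forall a, v 0 (cf a) = 0.
Proof.
by move=> z1 z2 th a; have := th a; rewrite pairing_contact z1 z2 !mulr0 !subr0.
Qed.

Lemma sum_vertical v (c : 'I_6 -> R) : (forall b, v 0 (cf b) = 0) ->
  \sum_b c b * v 0 (cf b) = 0.
Proof. by move=> v0; apply: big1 => b _; rewrite v0 mulr0. Qed.

(** There are 6 + 2 + 4 forms on a tangent space of dimension 12, so it suffices that no nonzero
    tangent vector is annihilated by all of them. *)
Lemma coframe x : x 0 ju != 0 ->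
  coframe_at S x (row_mx (row_mx (contact_forms x) (independence_forms x)) (pi_forms x)).
Proof.
move=> u0; rewrite /coframe_at /independent_at rank_tangent// eqxx andbT.
rewrite rank_mul_inj ?rank_tangent// => v vT; rewrite !mul_mx_row => /eqP.
rewrite !row_mx_eq0 => /andP[/andP[/eqP th /eqP om] /eqP pi].
have z1 : v 0 jz1 = 0.
  by have := pairing_independence v x 0; rewrite pairing_col om mxE.
have z2 : v 0 jz2 = 0.
  by have := pairing_independence v x 1; rewrite pairing_col om mxE.
have vf : forall a, v 0 (cf a) = 0.
  by apply: (vertical_contact (x := x)) => // a; rewrite pairing_col th mxE.
have p e := pairing_pi v x e.
have m11 : v 0 jm11 = 0.
  by have := p 0; rewrite pairing_col pi mxE /= z2 mulr0 subr0.
have u11 : v 0 ju11 = 0.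
  by have := p 1; rewrite pairing_col pi mxE /= z1 mulr0 addr0.
have u12 : v 0 ju12 = 0 by have := p 2; rewrite pairing_col pi mxE.
have u22 : v 0 ju22 = 0 by have := p 3; rewrite pairing_col pi mxE.
have [m12 m22] := tangentP v u0 vT.
by apply: row14P => //; rewrite ?m12 ?m22 !sum_vertical// u11 u22 addr0 mulr0 addr0.
Qed.

Lemma independent_contact x : x 0 ju != 0 ->
  independent_at S x (row_mx (contact_forms x) (independence_forms x)).
Proof.
move=> /coframe; set al := row_mx (contact_forms x) _ => /andP[/row_fullP[B] + _].
rewrite mul_mx_row mul_mx_row => BE.
apply/row_fullP; exists (usubmx B).
move/(congr1 lsubmx): BE; rewrite row_mxKl => BE; rewrite mul_usub_mx BE.
by apply/matrixP => i j; rewrite !mxE (inj_eq (@lshift_inj _ _)).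
Qed.

Lemma sum_contact (k : 'I_6 -> R) v x : \sum_b k b * pairing v (col b (contact_forms x)) =
  \sum_b k b * v 0 (cf b) - (\sum_b k b * x 0 (cf1 b)) * v 0 jz1
    - (\sum_b k b * x 0 (cf2 b)) * v 0 jz2.
Proof.
rewrite !mulr_suml -!sumrB; apply: eq_bigr => b _; rewrite pairing_contact; ring.
Qed.

End Structure.

(** * Structure equations, the tableau of an arbitrary coframing, and involutivity *)

Section Dependence.
Variable R : realType.
Implicit Types (x v w : 'rV[R]_14).

Local Notation S := (restricted_contact_system R).
Local Notation cf a := (contact_index a).1.1.
Local Notation cf1 a := (contact_index a).1.2.
Local Notation cf2 a := (contact_index a).2.
Local Notation ratio x := (x 0 jm / x 0 ju).

Lemma sum_delta n (k : 'I_n) (F : 'I_n -> R) : \sum_b (b == k)%:R * F b = F k.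
Proof.
rewrite (bigD1 k)//= eqxx mul1r big1 ?addr0// => b /negPf ->; by rewrite mul0r.
Qed.

Lemma symbol_sum (c : R) (p : 'I_4 -> R) a i :
  \sum_e symbol c (- delta_mx 0 e) a i * p e = - symbol c (\row_e p e) a i.
Proof.
rewrite (row_sum_delta (\row_e p e)) linear_sum summxE -sumrN; apply: eq_bigr => e _.
by rewrite linearZ linearN /= !mxE mulNr mulrC.
Qed.

(** The forms multiplying the [theta^b] are combinations of [dz1] and [dz2]. They arise when the
    differentials of dependent jet coordinates are written through contact forms; [residual1]
    collects the [dz1] parts, [residual2] the [dz2] parts. *)
Definition residual1 x (a : 'I_6) : 'I_6 -> R := nth (fun=> 0)
  [:: (fun b => (b == 1)%:R); (fun=> 0); coefL x; (fun b => (b == 4)%:R); (fun=> 0);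
    (fun=> 0)] a.
Definition residual2 x (a : 'I_6) : 'I_6 -> R := nth (fun=> 0)
  [:: (fun b => (b == 2)%:R); coefL x; coefC x; (fun b => (b == 5)%:R); (fun=> 0);
    (fun=> 0)] a.

(** The two corrections in [pi_forms] do not interfere: [dm_11] and [du_11] meet only [dz1] in the
    rows of [m_1] and [u_1], so the [dz1] term of the latter acts in the row of [m_2] alone. *)
Lemma structure x : x 0 jm != 0 -> x 0 ju != 0 ->
  structure_equations S x (pi_forms x) (fun e => symbol (ratio x) (- delta_mx 0 e))
    (fun=> 0).
Proof.
move=> m0 u0; split; first exact: coframe.
move=> a; exists (fun b => residual1 x a b *: dcoord R jz1 + residual2 x a b *: dcoord
  R jz2).
move=> v w /(tangentP _ u0)[v12 v22] /(tangentP _ u0)[w12 w22].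
rewrite dthetaE [X in _ = _ + X + _]big1 ?addr0 => [|i _]; last first.
  by rewrite big1// => j _; rewrite mxE mul0r.
pose p u e := pairing u (col e (pi_forms x)).
have -> : \sum_e \sum_i symbol (ratio x) (- delta_mx 0 e) a i *
    wedge (col e (pi_forms x)) (col i (independence_forms x)) v w =
  - (symbol (ratio x) (\row_e p v e) a 0 * w 0 jz1 + symbol (ratio x) (\row_e p v e) a
    1 * w 0 jz2)
  + (symbol (ratio x) (\row_e p w e) a 0 * v 0 jz1 + symbol (ratio x) (\row_e p w e) a
    1 * v 0 jz2).
  have E i : \sum_e symbol (ratio x) (- delta_mx 0 e) a i *
      wedge (col e (pi_forms x)) (col i (independence_forms x)) v w =
      - symbol (ratio x) (\row_e p v e) a i * w 0 (if i == 0 then jz1 else jz2)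
      + symbol (ratio x) (\row_e p w e) a i * v 0 (if i == 0 then jz1 else jz2).
    rewrite -symbol_sum -[X in _ + X * _]opprK -symbol_sum mulNr !mulr_suml -sumrB.
    by apply: eq_bigr => e _; rewrite /wedge !pairing_independence /p; ring.
  rewrite exchange_big /= big_ord_recl big_ord1 !E (_ : lift ord0 ord0 = 1); last
    exact: val_inj.
  by rewrite /=; ring.
have -> : \sum_b wedge (residual1 x a b *: dcoord R jz1 + residual2 x a b *: dcoord R jz2)
      (col b (contact_forms x)) v w =
    v 0 jz1 * (\sum_b residual1 x a b * pairing w (col b (contact_forms x)))
    + v 0 jz2 * (\sum_b residual2 x a b * pairing w (col b (contact_forms x)))
    - w 0 jz1 * (\sum_b residual1 x a b * pairing v (col b (contact_forms x)))
    - w 0 jz2 * (\sum_b residual2 x a b * pairing v (col b (contact_forms x))).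
  rewrite !mulr_sumr -big_split -!sumrB /=; apply: eq_bigr => b _.
  by rewrite /wedge !pairingD !pairingZ !pairing_dcoord; ring.
have ct : ratio x * tau x = beta x (fun b => cf1 b) - alpha x (fun b => cf2 b).
  by rewrite /tau mulrC divfK// mulf_neq0 ?invr_neq0.
have z0 u : \sum_(b < 6) 0 * pairing u (col b (contact_forms x)) = 0.
  by rewrite big1// => b _; rewrite mul0r.
have L u := sum_contact (coefL x) u x; have C u := sum_contact (coefC x) u x.
have P u e := pairing_pi u x e.
case: a => -[|[|[|[|[|[|a]]]]]] ha //; rewrite /residual1 /residual2 /=.
- rewrite !sum_delta !pairing_contact !mxE /=; ring.
- by rewrite !z0 !L -v12 -w12 !mxE /= /p !P /= -/(alpha x _) -/(alpha x _); ring.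
- rewrite !L !C -/(alpha x _) -/(alpha x _) -/(beta x _) -/(beta x _) -v12 -w12.
  have -> : \sum_b coefC x b * v 0 (cf b) = v 0 jm22 - ratio x * (v 0 ju11 + v 0 ju22).
    by rewrite v22 addrK.
  have -> : \sum_b coefC x b * w 0 (cf b) = w 0 jm22 - ratio x * (w 0 ju11 + w 0 ju22).
    by rewrite w22 addrK.
  rewrite !mxE /= /p !P /=.
  (* The rewriting is made twice, for [v] and for [w]; it trades [tau] for the torsion coefficient
     that it cancels. *)
  have -> : forall a1 b1 z, ratio x * (a1 + tau x * z + b1) =
      ratio x * (a1 + b1) + (beta x (fun b => cf1 b) - alpha x (fun b => cf2 b)) * z.
    by move=> a1 b1 z; rewrite -ct; ring.
  have -> : forall a1 b1 z, ratio x * (a1 + tau x * z + b1) =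
      ratio x * (a1 + b1) + (beta x (fun b => cf1 b) - alpha x (fun b => cf2 b)) * z.
    by move=> a1 b1 z; rewrite -ct; ring.
  by ring.
- rewrite !sum_delta !pairing_contact !mxE /=; ring.
- rewrite !z0 !mxE /= /p !P /=; ring.
- rewrite !z0 !mxE /= /p !P /=; ring.
Qed.

Lemma linear_pfaffian_restricted : linear_pfaffian S.
Proof.
have mu x : manifold S x -> x 0 jm != 0 /\ x 0 ju != 0 by case.
split; [split|] => [|x /mu[m0 u0]|x /mu[m0 u0]].
- have o k : open [set j : 'rV[R]_14 | j 0 k != 0].
    rewrite (_ : [set j : 'rV[R]_14 | j 0 k != 0] = (fun j : 'rV[R]_14 => j 0 k) @^-1`
      [set y : R | y != 0])//.
    by apply: open_comp => [j _|]; [exact: coord_continuous|exact: open_neq].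
  exact: openI (o jm) (o ju).
- by split; [exact: differentiable_jet_equations|exact: rank_jacobian].
split; first exact: independent_contact.
move=> a; exists (fun=> 0), (fun i => - dcoord R (if i == 0 then cf1 a else cf2 a)).
move=> v w _ _; rewrite dthetaE big1 => [|b _]; last by rewrite /wedge /pairing !mulmx0
  !mxE !mul0r subr0.
rewrite !big_ord_recl big_ord0 /wedge !pairingN !pairing_dcoord !pairing_independence /=.
by ring.
Qed.

Lemma vertical_symbol x v : x 0 ju != 0 -> (v <= tangent S x)%MS ->
  (forall b, v 0 (cf b) = 0) -> forall a (i : 'I_2), v 0 (if i == 0 then cf1 a else cf2
    a) =
    symbol (ratio x) (\row_e nth 0 [:: v 0 jm11; v 0 ju11; v 0 ju12; v 0 ju22] e) a i.
Proof.
move=> u0 /(tangentP _ u0)[v12 v22] vf a i; rewrite sum_vertical// in v12.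
rewrite sum_vertical// add0r in v22.
have [f1 f2] : v 0 jm1 = 0 /\ v 0 jm2 = 0 by split; [exact: (vf 1)|exact: (vf 2)].
have [f4 f5] : v 0 ju1 = 0 /\ v 0 ju2 = 0 by split; [exact: (vf 4)|exact: (vf 5)].
case: a => -[|[|[|[|[|[|a]]]]]] ha //; case: i => -[|[|i]] hi //; by rewrite !mxE /= ?mxE.
Qed.

Definition vertical_lift (c : R) (y : 'rV[R]_4) : 'rV[R]_14 := \row_k nth 0
  [:: 0; 0; 0; 0; 0; y 0 0; 0; c * (y 0 1 + y 0 3); 0; 0; 0; y 0 1; y 0 2; y 0 3] k.

Lemma vertical_lift_tangent x y : x 0 ju != 0 ->
  (vertical_lift (ratio x) y <= tangent S x)%MS.
Proof.
move=> u0; apply/(tangentP _ u0).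
rewrite !sum_vertical; first by rewrite !mxE /= add0r.
all: by move=> -[[|[|[|[|[|[|b]]]]]] hb] //; rewrite !mxE.
Qed.

(** The matrices [A_e] depend on the coframing, but their span does not: it is the image of the
    tangent vectors annihilated by all [theta] and [omega] under the map [v |-> - symbol v]. *)
Lemma tableau_at_symbol x A : x 0 jm != 0 -> x 0 ju != 0 ->
  tableau_at S x A -> A = symbol_space (ratio x).
Proof.
move=> m0 u0 [r [Pi [As [T [[/andP[/row_fullP[B BE] _] st] ->]]]]].
set al := row_mx _ Pi in BE.
(* The basis of the tangent space dual to the given coframe. *)
pose d k := row k (B *m tangent S x).
have dT k : (d k <= tangent S x)%MS by rewrite (submx_trans (row_sub _ _))// submxMl.
have dE k l : (d k *m al) 0 l = (k == l)%:R by rewrite -row_mul -mulmxA BE !mxE.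
have dth k a : pairing (d k) (col a (contact_forms x)) = (k == lshift r (lshift 2 a))%:R.
  by rewrite -dE /al !mul_mx_row !row_mxEl pairing_col.
have dom k i : pairing (d k) (col i (independence_forms x)) = (k == lshift r (rshift 6
  i))%:R.
  by rewrite -dE /al !mul_mx_row row_mxEl row_mxEr pairing_col.
have dpi k e : pairing (d k) (col e Pi) = (k == rshift (6 + 2) e)%:R.
  by rewrite -dE /al mul_mx_row row_mxEr pairing_col.
(* Evaluated on a vertical [v] and the vector dual to [omega^i], the structure equations lose their
   torsion and [theta] terms, and column [i] of the sum of [pi^e(v) A_e] remains. *)
have key v : (v <= tangent S x)%MS -> v 0 jz1 = 0 -> v 0 jz2 = 0 -> (forall b, v 0 (cf
  b) = 0) ->
    \sum_e pairing v (col e Pi) *: As e =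
    - symbol (ratio x) (\row_e nth 0 [:: v 0 jm11; v 0 ju11; v 0 ju12; v 0 ju22] e).
  move=> vT z1 z2 vf; apply/matrixP => a i.
  pose w := d (lshift r (rshift 6 i)).
  have vth b : pairing v (col b (contact_forms x)) = 0.
    by rewrite pairing_contact vf z1 z2 !mulr0 !subr0.
  have wth b : pairing w (col b (contact_forms x)) = 0.
    by rewrite dth (inj_eq (@lshift_inj _ _)) eq_rlshift.
  have vom j : pairing v (col j (independence_forms x)) = 0.
    by rewrite pairing_independence; case: ifP.
  have wom j : pairing w (col j (independence_forms x)) = (j == i)%:R.
    by rewrite dom (inj_eq (@lshift_inj _ _)) (inj_eq (@rshift_inj _ _)) eq_sym.
  have wpi e : pairing w (col e Pi) = 0 by rewrite dpi eq_lrshift.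
  have [be] := st a => /(_ v w vT (dT _)).
  rewrite [X in _ = _ + X]big1 ?addr0 => [|b _]; last by rewrite /wedge vth wth !mulr0
    subrr.
  rewrite [X in _ = _ + X]big1 ?addr0 => [|k _]; last first.
    by rewrite big1// => l _; rewrite /wedge !vom !mul0r mulr0 subrr mulr0.
  rewrite dthetaE z1 z2 !mulr0 add0r sub0r => E.
  rewrite [RHS]mxE -(vertical_symbol u0 vT vf) summxE.
  transitivity (\sum_e \sum_j As e a j * wedge (col e Pi) (col j (independence_forms
    x)) v w).
    apply: eq_bigr => e _; rewrite mxE.
    have E2 j : As e a j * wedge (col e Pi) (col j (independence_forms x)) v w =
        (j == i)%:R * (As e a j * pairing v (col e Pi)).
      by rewrite /wedge wpi wom; ring.
    by under [RHS]eq_bigr do rewrite E2; rewrite sum_delta mulrC.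
  rewrite -E; congr (- _).
  have := pairing_independence w x 0; have := pairing_independence w x 1; rewrite !wom
    /= => <- <-.
  by case: i {E wom w wth wpi} => -[|[|i]] hi //=; rewrite !(mulr0, mulr1) ?addr0 ?add0r.
apply/vspaceP => M; apply/idP/symbol_spaceP => [|[y ->]].
  suff /subvP sub : (<<codom As>> <= symbol_space (ratio x))%VS by move=> /sub
    /symbol_spaceP.
  apply/span_subvP => _ /codomP[e ->]; apply/symbol_spaceP.
  pose v := d (rshift (6 + 2) e).
  have z1 : v 0 jz1 = 0 by have := pairing_independence v x 0; rewrite dom eq_rlshift.
  have z2 : v 0 jz2 = 0 by have := pairing_independence v x 1; rewrite dom eq_rlshift.
  have vf : forall b, v 0 (cf b) = 0.
    by apply: (vertical_contact (x := x)) => // a; rewrite dth eq_rlshift.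
  have := key v (dT _) z1 z2 vf.
  rewrite (bigD1 e)//= dpi eqxx scale1r big1 ?addr0 => [->|e' ne]; last first.
    by rewrite dpi (inj_eq (@rshift_inj _ _)) eq_sym (negPf ne) scale0r.
  by exists (- (\row_e nth 0 [:: v 0 jm11; v 0 ju11; v 0 ju12; v 0 ju22] e)); rewrite
    linearN.
(* The minus sign cancels the one in [key], so the given symbol is a combination of the [A_e]. *)
pose v := vertical_lift (ratio x) (- y).
have vf b : v 0 (cf b) = 0.
  by case: b => -[|[|[|[|[|[|b]]]]]] hb //; rewrite !mxE.
have := key v (vertical_lift_tangent _ u0) _ _ vf; rewrite ![v 0 jz1]mxE ![v 0 jz2]mxE
  => /(_ erefl erefl).
rewrite (_ : (\row_e _) = - y); last first.
  by apply/eqP; rewrite -subr_eq0; apply/eqP/row4P; rewrite !mxE /= ?mxE /= subrr.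
rewrite linearN opprK => <-; apply: memv_suml => e _; apply: memvZ; apply: memv_span.
exact: codom_f.
Qed.

Lemma dependence : cartan_kaehler_dependence S 4 1.
Proof.
have mu x : manifold S x -> x 0 jm != 0 /\ x 0 ju != 0 by case.
split; first exact: linear_pfaffian_restricted.
  move=> x /mu[m0 u0]; split; first by do 3 eexists; exact: structure.
  move=> A /(tableau_at_symbol m0 u0) ->; apply: involutive_symbol.
  by rewrite mulf_neq0 ?invr_neq0.
move=> x /mu[m0 u0] A /(tableau_at_symbol m0 u0) ->; apply: last_character_symbol.
by rewrite mulf_neq0 ?invr_neq0.
Qed.

End Dependence.

Theorem proposition8p1 (R : realType) :
  (forall j : 'rV[R]_14, manifold (restricted_contact_system R) j ->
     exists (U : set (R * R)) (m u : R -> R -> R),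
       [/\ open U, U (j 0 jz1, j 0 jz2), analytic_solution U m u &
           jet2 m u (j 0 jz1) (j 0 jz2) = j]) /\
  cartan_kaehler_dependence (restricted_contact_system R) 4 1.
Proof. by split; [exact: local_existence|exact: dependence]. Qed.
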